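(* There exists a family of finite trees showing that the bound $\lambda_2\le\frac{4(D-1)}{|\delta\Omega|}$, valid for finite trees with all vertex degrees at most $D$, cannot in general be improved to a bound of the form $\lambda_2\le\frac{c(D)}{|V|}$ with a constant $c(D)>0$ depending only on $D$, and that the assumption $\deg(x)\ge 3$ for all $x\in\Omega$ is necessary in the bound $\lambda_2\le\frac{8(D-1)}{|V|+2}$ (valid for finite trees with all vertex degrees at most $D$ that satisfy this assumption), in the sense that without it no bound of the form $\lambda_2\le\frac{c(D)}{|V|}$ holds in general. To be precise, let $T_3$ be the homogeneous (infinite regular) tree of degree three with combinatorial distance $d$, let $l\in\mathbb{N}$, and let $\mathcal{G}_1=(V_1,E_1)$ be the subgraph of $T_3$ generated (induced) by the ball $B(o,l)=\{x: d(o,x)\le l\}$, where $o\in V_1$. Refine $\mathcal{G}_1$ to get a tree $\mathcal{G}=(V,E)$ by adding $k$ vertices to each edge $(x,y)$ with $d(o,x)=k$, $d(o,y)=k+1$ and $1\le k\le l-1$ (so that such an edge is replaced by a path of $k+1$ edges). Let $\delta\Omega$ and $\delta\Omega_1$ be the boundaries of $\mathcal{G}$ and $\mathcal{G}_1$ respectively. Then $$|\delta\Omega|=|\delta\Omega_1|=3\cdot 2^{l-1},\qquad l\,|\delta\Omega|\leq |V|=|V_1|+\sum_{k=1}^{l-1}3\cdot 2^k\cdot k\leq 2l\,|\delta\Omega|.$$ Furthermore, $$\frac{3}{4|\delta\Omega|}\leq \lambda_2(\mathcal{G})\leq \frac{3}{2|\delta\Omega|}.$$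
   Context: Let $\mathcal{G}=(V,E)$ be a finite tree (simple, undirected) with at least three vertices. Its boundary $\delta\Omega$ is the set of vertices of degree one and its interior is $\Omega=V\setminus\delta\Omega$; $\deg(x)$ is the degree of the vertex $x$ and $|\cdot|$ denotes cardinality. The combinatorial distance $d(x,y)$ is the number of edges in a shortest path from $x$ to $y$. The Steklov problem on $(\mathcal{G},\delta\Omega)$ is: for nonzero $f\in\mathbb{R}^V$ and $\lambda\in\mathbb{R}$, $\Delta f(x)=0$ for $x\in\Omega$ and $\frac{\partial f}{\partial n}(x)=\lambda f(x)$ for $x\in\delta\Omega$, where $(\Delta f)(x)=\sum_{y\sim x}(f(x)-f(y))$ and $\frac{\partial f}{\partial n}(x)=\sum_{y\in\Omega,\,y\sim x}(f(x)-f(y))$, with $y\sim x$ meaning that $x$ and $y$ are joined by an edge. The Steklov eigenvalues are the eigenvalues of the Dirichlet-to-Neumann operator on $\mathbb{R}^{\delta\Omega}$, $f\mapsto \frac{\partial\hat f}{\partial n}$, where $\hat f$ is the harmonic extension of $f$ ($\Delta\hat f=0$ on $\Omega$, $\hat f=f$ on $\delta\Omega$). This operator is self-adjoint and non-negative; its eigenvalues, counted with multiplicity, are ordered $0=\lambda_1\le\lambda_2\le\cdots\le\lambda_{|\delta\Omega|}$. Here $\lambda_2=\lambda_2(\mathcal{G})$ is called the first (nonzero) Steklov eigenvalue.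
   Formalization: The upper bound λ₂ ≤ 3/(2|δΩ|) is stated only for l ≥ 2, because for l = 1 the tree is the star with three leaves, where λ₂ = 1 > 1/2; everything else is stated for all l ≥ 1. *)

(* Defs.v *)
From HB Require Import structures.
From mathcomp Require Import all_boot all_order all_algebra finmap.
From mathcomp Require Import boolp classical_sets functions cardinality reals.

Set Implicit Arguments.
Unset Strict Implicit.
Unset Printing Implicit Defensive.

Import Order.TTheory GRing.Theory Num.Theory.

Local Open Scope ring_scope.

(* A graph, finite or not, is given by its adjacency relation. *)
Section Graph.
Variables (T : eqType) (e : rel T).

Definition graph_connected : Prop :=
  forall x y, exists2 p, path e x p & last x p = y.

Definition graph_acyclic : Prop :=
  forall c : seq T, (2 < size c)%N -> uniq c -> ~~ cycle e c.

Definition is_tree : Prop :=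
  [/\ symmetric e, irreflexive e, graph_connected & graph_acyclic].

(* Every vertex has exactly [q] neighbours. *)
Definition regular (q : nat) : Prop :=
  forall x, exists s : seq T, [/\ uniq s, size s = q & forall y, (y \in s) = e x y].

(* For q >= 2 such a tree is infinite, and it is unique up to isomorphism. *)
Definition homogeneous_tree (q : nat) : Prop := is_tree /\ regular q.

Definition is_dist (x y : T) (n : nat) : Prop :=
  (exists p, [/\ path e x p, last x p = y & size p = n]) /\
  (forall p, path e x p -> last x p = y -> (n <= size p)%N).

Definition dist (x y : T) : nat := xget 0%N [set n | is_dist x y n]%classic.

End Graph.

Section Steklov.
Variables (R : realType) (V : finType) (e : rel V).

Definition deg (x : V) : nat := #|[set y | e x y]|.

Definition bdry : {set V} := [set x | deg x == 1%N].
Definition inner : {set V} := ~: bdry.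

Definition bdry_vertex := {x : V | x \in bdry}.

Definition laplacian (f : {ffun V -> R}) (x : V) : R :=
  \sum_(y | e x y) (f x - f y).

Definition normal_derivative (f : {ffun V -> R}) (x : V) : R :=
  \sum_(y | (y \in inner) && e x y) (f x - f y).

Definition is_harmonic_extension (f : {ffun bdry_vertex -> R})
    (u : {ffun V -> R}) : Prop :=
  (forall x, x \in inner -> laplacian u x = 0) /\
  (forall x : bdry_vertex, u (val x) = f x).

(* On a tree with at least three vertices the extension exists and is unique. *)
Definition harmonic_extension (f : {ffun bdry_vertex -> R}) : {ffun V -> R} :=
  xget 0 [set u | is_harmonic_extension f u]%classic.

Definition DtN (f : {ffun bdry_vertex -> R}) : {ffun bdry_vertex -> R} :=
  [ffun x => normal_derivative (harmonic_extension f) (val x)].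

(* Matrix of DtN in the canonical basis of the functions on the boundary. *)
Definition DtN_mx : 'M[R]_#|{: bdry_vertex}| :=
  \matrix_(i, j) DtN [ffun y => (y == enum_val j)%:R] (enum_val i).

Definition is_spectrum n (A : 'M[R]_n) (s : seq R) : Prop :=
  sorted <=%R s /\ char_poly A = \prod_(a <- s) ('X - a%:P).

(* Nondecreasing, with multiplicity; lambda_k is the item of index k - 1. *)
Definition steklov_spectrum : seq R :=
  xget [::] [set s | is_spectrum DtN_mx s]%classic.

Definition lambda2 : R := nth 0 steklov_spectrum 1.

End Steklov.

Arguments lambda2 R {V} e.

Definition is_linear_bound (R : realType) (D : nat) (c : R) : Prop :=
  forall (V : finType) (e : rel V),
    is_tree e -> (3 <= #|V|)%N -> (forall x, deg e x <= D)%N ->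
    lambda2 R e <= c / #|V|%:R.

(* Refinement of a graph with levels [h]: [h x] vertices are inserted on each
   edge (x, y) with h y = h x + 1.  In a tree, with h the distance to a fixed
   vertex, each edge is of this form for exactly one of its orientations. *)
Section Refinement.
Variables (V : finType) (e : rel V) (h : V -> nat).

Definition upward (a : V * V) : bool := e a.1 a.2 && (h a.2 == (h a.1).+1).

Definition added (a : V * V) : nat := if upward a then h a.1 else 0%N.

Definition refined_vertex : finType :=
  (V + {a : (V * V)%type & 'I_(added a)})%type.

(* The position, from 0 to (added a).+1, of a vertex on the path replacing the
   edge [a], if it lies on that path. *)
Definition position (a : V * V) (u : refined_vertex) : option nat :=
  match u with
  | inl x => if x == a.1 then Some 0%N
             else if x == a.2 then Some (added a).+1 else None
  | inr v => if tag v == a then Some (tagged v).+1 else None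
  end.

Definition refined_adj : rel refined_vertex := fun u v =>
  [exists a, upward a &&
    match position a u, position a v with
    | Some i, Some j => (i == j.+1) || (j == i.+1)
    | _, _ => false
    end].

End Refinement.

Section Construction.
Variables (T : choiceType) (e : rel T) (o : T) (l : nat).

(* [fset_set A] has the elements of A when A is finite, as balls are in a
   homogeneous tree. *)
Definition ball : {fset T} := fset_set [set x | (dist e o x <= l)%N]%classic.

Definition G1_vertex : finType := ball.
Definition G1_adj : rel G1_vertex := fun x y => e (val x) (val y).

Definition level (x : G1_vertex) : nat := dist e o (val x).

(* Distances are taken in the whole tree.  No vertex is inserted on the edges
   at o, as their lower endpoint has level 0, and adjacent vertices of the ball
   have levels k and k + 1 with k <= l - 1. *)
Definition G_vertex : finType := refined_vertex G1_adj level.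
Definition G_adj : rel G_vertex := @refined_adj G1_vertex G1_adj level.

End Construction.

Arguments G1_vertex {T} e o l.
Arguments G1_adj {T} e o l.
Arguments G_vertex {T} e o l.
Arguments G_adj {T} e o l.

(* Main.v *)
Require Import Defs.
From HB Require Import structures.
From mathcomp Require Import all_boot all_order all_algebra finmap.
From mathcomp Require Import boolp classical_sets functions cardinality reals.
From mathcomp Require Import complex.
From mathcomp Require Import ring lra zify.

(** In the refined ball, the edge leading to a vertex of level k becomes a path
of k edges, that is, a resistor of resistance k. There are 3 2^(k-1) such
paths, so that the long ones contain most of the vertices of the tree; but a
current from the root to the leaves divides among them, so that together they
add little resistance. A branch at the root has the effective resistance
sum_(1 <= k <= l) k / 2^(k-1), which lies between 2 and 4 for l >= 2, and it
carries a third of the leaves. Hence the first Steklov eigenvalue is of order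
1 / #|boundary|, while the number of vertices is of order l * #|boundary|.
Choosing l large defeats any bound of the form c / #|V|.

Both estimates are variational. The Dirichlet-to-Neumann matrix is the Gram
matrix, for the Dirichlet form, of the harmonic extensions of the indicator
functions of the boundary vertices ([DtN_mxE]). It is therefore symmetric, and
the Courant-Fischer principle ([le_second_eigenvalue],
[second_eigenvalue_le]) together with the Dirichlet principle
([qform_DtN_le]) compares its second eigenvalue with Rayleigh quotients
([lambda2_ge], [lambda2_le]). The Courant-Fischer principle is derived from
the unitary diagonalisation of the matrix over the complex numbers.

For the lower bound one proves a Poincare inequality: the sum of
(u - u root)^2 over the leaves is at most 2^(l+1) times the Dirichlet energy
of u ([level_poincare]). The induction on levels is the Cauchy-Schwarz
inequality along the paths from the root, with the weights that are optimal for
a current split evenly at every vertex. For the upper bound one uses the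
function [test_fun] that takes opposite values on two branches at the root and
is constant beyond level 2.

The combinatorics goes through parent functions. In a tree, a vertex other than
the root has exactly one neighbour that is no farther from the root
([closer_neighbour_unique]), so distances give a parent function; the refined
ball has an explicit one ([refined_rooted]). A parent function with a height
that decreases along it yields a tree ([rooted_is_tree]), gives the degrees by
counting children ([rooted_deg]), and writes the Dirichlet energy as a sum over
the vertices other than the root ([dirichlet_rooted]). *)

Set Implicit Arguments.
Unset Strict Implicit.
Unset Printing Implicit Defensive.

Import Order.TTheory GRing.Theory Num.Theory.

(** * Trees given by a parent function *)

(** The height only has to decrease towards the root, so that distances, the
positions in a refined tree and the numbering of a heap are all instances. *)
Definition rooted (T : eqType) (e : rel T) (o : T) (p : T -> T) (h : T -> nat) : Prop :=
  (forall x y, e x y = (x != o) && (y == p x) || (y != o) && (x == p y)) /\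
  (forall x, x != o -> h (p x) < h x).

Section Rooted.
Variables (T : eqType) (e : rel T) (o : T) (p : T -> T) (h : T -> nat).
Hypothesis e_rooted : rooted e o p h.

Lemma rooted_sym : symmetric e.
Proof. by case: e_rooted => adj _ x y; rewrite !adj orbC. Qed.

Lemma rooted_irr : irreflexive e.
Proof.
case: e_rooted => adj desc x; rewrite adj orbb; apply/negP => /andP[xo /eqP xp].
by have := desc x xo; rewrite -xp ltnn.
Qed.

Lemma rooted_lower x y : e x y -> h y <= h x -> y = p x.
Proof.
case: e_rooted => adj desc; rewrite adj => /orP[/andP[_ /eqP //]|].
by move=> /andP[yo /eqP ->]; rewrite leqNgt desc.
Qed.

Lemma rooted_connected : graph_connected e.
Proof.
have [adj desc] := e_rooted.
have to_root x : exists2 s, path e x s & last x s = o.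
  have [n] := ubnP (h x); elim: n x => // n IH x; rewrite ltnS => hx.
  have [->|xo] := eqVneq x o; first by exists [::].
  have [|s ps ls] := IH (p x); first by rewrite (leq_trans (desc x xo)).
  by exists (p x :: s) => //=; rewrite adj xo eqxx ps.
move=> x y; have [s ps ls] := to_root x; have [t pt lt] := to_root y.
exists (s ++ rev (belast y t)).
  rewrite cat_path ps ls -lt rev_path.
  by rewrite (eq_path (e' := e)) // => a b; rewrite /= rooted_sym.
rewrite last_cat ls; case: t {pt} lt => [/= -> //|z t _] /=.
by rewrite rev_cons last_rcons.
Qed.

Lemma exists_argmax (c : seq T) : c != [::] ->
  exists2 x, x \in c & {in c, forall y, h y <= h x}.
Proof.
elim: c => // x [_ _|y c /(_ isT)[z zc zmax] _].
  by exists x => [|y]; rewrite ?mem_head // inE => /eqP ->.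
have [hz|hx] := leqP (h x) (h z).
  exists z => [|w]; rewrite inE ?zc ?orbT // => /orP[/eqP -> //|]; exact: zmax.
exists x => [|w]; rewrite inE ?eqxx // => /orP[/eqP -> //|/zmax hw].
exact: leq_trans hw (ltnW hx).
Qed.

(** A highest vertex of a cycle would have two distinct neighbours that are no
higher than itself, but its parent is the only one. *)
Lemma rooted_acyclic : graph_acyclic e.
Proof.
move=> c sc uc; apply/negP => cc.
have [|x xc xmax] := @exists_argmax c; first by case: c sc {uc cc}.
have [i s rc] := rot_to xc.
have sub y : y \in x :: s -> h y <= h x by rewrite -rc mem_rot; apply: xmax.
move: cc uc sc; rewrite -(rot_cycle i) -(rot_uniq i) -(size_rot i) {}rc {c xc xmax}.
case: s sub => // y t; case/lastP: t => // t z sub /= /andP[exy].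
rewrite rcons_path last_rcons => /andP[_ ezx] /andP[_ /andP[+ _]] _.
have -> : y = p x by apply: rooted_lower exy _; apply: sub; rewrite !inE eqxx orbT.
rewrite -[p x](@rooted_lower x z).
- by rewrite mem_rcons mem_head.
- by rewrite rooted_sym.
- by apply: sub; rewrite !inE mem_rcons inE eqxx !orbT.
Qed.

Lemma rooted_is_tree : is_tree e.
Proof.
split; [exact: rooted_sym|exact: rooted_irr|exact: rooted_connected|].
exact: rooted_acyclic.
Qed.

End Rooted.

Definition children (V : finType) (o : V) (p : V -> V) (x : V) : {set V} :=
  [set y | (y != o) && (p y == x)].

Lemma rooted_deg (V : finType) (e : rel V) o p h x : rooted e o p h ->
  deg e x = (x != o) + #|children o p x|.
Proof.
move=> rt; have [adj desc] := rt; rewrite /deg.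
have [xo|xo] := eqVneq x o.
  rewrite add0n; apply: eq_card => y; rewrite !inE adj xo eqxx /=.
  by rewrite [o == _]eq_sym.
rewrite (cardsD1 (p x)) inE adj xo eqxx /=; congr (_ + _).
apply: eq_card => y; rewrite !inE adj xo /= [x == _]eq_sym.
have [->|_ //] := eqVneq y (p x).
apply/esym/negP => /andP[pxo /eqP ppx].
have := desc _ pxo; rewrite ppx => /ltn_trans/(_ (desc _ xo)); by rewrite ltnn.
Qed.

(** A model of the homogeneous tree of degree three: the children of 0 are 1, 2
and 3, those of n > 0 are 2n+2 and 2n+3. The truncated predecessor takes care
of n = 1. *)
Definition heap_parent (n : nat) : nat := n./2.-1.
Definition heap_adj : rel nat := fun x y =>
  (x != 0) && (y == heap_parent x) || (y != 0) && (x == heap_parent y).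

Lemma heap_rooted : rooted heap_adj 0 heap_parent id.
Proof. by split=> // x x0; rewrite /heap_parent; lia. Qed.

Lemma heap_homogeneous : homogeneous_tree heap_adj 3.
Proof.
split; first exact: rooted_is_tree heap_rooted.
case=> [|x].
  exists [:: 1; 2; 3]; split=> // y; rewrite /heap_adj /heap_parent !inE /=; lia.
exists [:: heap_parent x.+1; x.*2.+4; x.*2.+4.+1]; split=> //.
  by rewrite /= !inE /heap_parent; lia.
move=> y; rewrite /heap_adj /heap_parent !inE /=; lia.
Qed.

(** * Distances to a vertex of a tree *)

Section TreeDistance.
Variables (T : choiceType) (e : rel T) (o : T).
Hypothesis e_tree : is_tree e.
Local Notation d := (dist e o).

Lemma distP x : is_dist e o x (d x).
Proof.
have [_ _ conn _] := e_tree.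
suff [n dn] : exists n, is_dist e o x n by exact: (xgetPex 0 (ex_intro _ n dn)).
pose P n := `[< exists s, [/\ path e o s, last o s = x & size s = n] >].
have exP : exists n, P n.
  by have [s ps ls] := conn o x; exists (size s); apply/asboolP; exists s.
case: (ex_minnP exP) => n /asboolP Pn minP; exists n; split=> // s ps ls.
by apply: minP; apply/asboolP; exists s.
Qed.

Lemma dist_path x : exists s, [/\ path e o s, last o s = x & size s = d x].
Proof. by case: (distP x). Qed.

Lemma dist_le s : path e o s -> d (last o s) <= size s.
Proof. by move=> ps; case: (distP (last o s)) => _; apply. Qed.

Lemma dist_root : d o = 0.
Proof. by apply/eqP; rewrite -leqn0; apply: (@dist_le [::]). Qed.

Lemma dist_eq0 x : (d x == 0) = (x == o).
Proof.
apply/eqP/eqP => [dx|->]; last exact: dist_root.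
by have [s [_ ls ss]] := dist_path x; rewrite dx in ss; rewrite -ls (size0nil ss).
Qed.

Lemma dist_step x y : e x y -> d y <= (d x).+1.
Proof.
move=> exy; have [s [ps lx <-]] := dist_path x.
rewrite -(size_rcons s y) -{1}(last_rcons o s y) dist_le //.
by rewrite rcons_path ps lx.
Qed.

Lemma dist_parent_exists x : x != o -> exists y, e x y && (d x == (d y).+1).
Proof.
have [sym _ _ _] := e_tree => xo.
have [s [+ + +]] := dist_path x; case/lastP: s => [_ /= ox|s x'].
  by rewrite ox eqxx in xo.
rewrite rcons_path last_rcons size_rcons => /andP[ps es] x'x sd; subst x'.
exists (last o s); rewrite sym es eqn_leq dist_step //=.
by rewrite -sd ltnS dist_le.
Qed.

(** Before its end, a shortest path from the root to y only visits vertices that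
are strictly closer to the root than y. *)
Lemma shortest_path_avoids x y : y != x -> d y <= d x ->
  exists s, [/\ path e o s, last o s = y & x \notin o :: s].
Proof.
move=> yx dyx; have [s [ps ly sd]] := dist_path y.
exists s; split=> //; apply/negP => /splitPl xs.
case: xs ps ly sd => s1 s2 lx; rewrite cat_path last_cat lx size_cat => /andP[p1 _] ly sd.
have := dist_le p1; rewrite lx; move: sd yx; case: s2 ly => [/= ->|? ? _ /=].
  by rewrite eqxx.
lia.
Qed.

(** Shortest paths from the root to y and to z avoid x. Glued at the root and
shortened, they give a simple path from y to z, which x closes up into a cycle
unless y = z. *)
Lemma closer_neighbour_unique x y z : e x y -> e x z ->
  d y <= d x -> d z <= d x -> y = z.
Proof.
have [sym irr _ acyc] := e_tree => exy exz dy dz; apply/eqP/negP => /negP yz.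
have yx : y != x by apply/eqP => yx; rewrite yx irr in exy.
have zx : z != x by apply/eqP => zx; rewrite zx irr in exz.
have [s [ps ly xs]] := shortest_path_avoids yx dy.
have [t [pt lz xt]] := shortest_path_avoids zx dz.
pose w := rev (belast o s) ++ t.
have ls : last y (rev (belast o s)) = o.
  case: s ly {ps xs w} => [/= -> //|a s _] /=.
  by rewrite rev_cons last_rcons.
have pw : path e y w.
  rewrite cat_path ls pt andbT -ly rev_path.
  by rewrite (eq_path (e' := e)) // => a b; rewrite /= sym.
have lw : last y w = z by rewrite last_cat ls lz.
have xw : x \notin y :: w.
  rewrite inE eq_sym negb_or yx mem_cat mem_rev negb_or /=.
  move: xt; rewrite inE negb_or => /andP[_ ->]; rewrite andbT.
  by apply: contra xs => /mem_belast.
case/shortenP: pw lw => w' pw' uw' sub lw'.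
have long : 2 < size [:: x, y & w'].
  by case: w' lw' {pw' uw' sub} => //= yz'; rewrite yz' eqxx in yz.
have simple : uniq [:: x, y & w'].
  rewrite cons_uniq uw' andbT; apply: contra xw; rewrite !inE => /orP[->//|].
  by move/sub ->; rewrite orbT.
have := acyc _ long simple.
by rewrite /= exy rcons_path pw' lw' sym exz.
Qed.

Definition dist_parent (x : T) : T :=
  xget x [set y | e x y && (d x == (d y).+1)]%classic.

Lemma dist_parentP x : x != o -> e x (dist_parent x) /\ d x = (d (dist_parent x)).+1.
Proof.
move=> /dist_parent_exists parent_ex.
have : (exists y, [set y | e x y && (d x == (d y).+1)]%classic y) by [].
by move/(xgetPex x) => /andP[-> /eqP].
Qed.

(** If two adjacent vertices had the same distance to the root, the parent of
either one and the other one would be two neighbours that are no farther from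
the root. *)
Lemma dist_rooted : rooted e o dist_parent d.
Proof.
have [sym irr _ _] := e_tree.
split=> [x y|x xo]; last by have [_ ->] := dist_parentP xo.
have up a b : e a b -> d b <= d a -> (a != o) && (b == dist_parent a).
  move=> eab dba; have [ao|ao] := eqVneq a o.
    move: dba; rewrite ao dist_root leqn0 dist_eq0 => /eqP bo.
    by rewrite ao bo irr in eab.
  have [ep dp] := dist_parentP ao; apply/eqP; apply: closer_neighbour_unique eab ep _ _ => //.
  by rewrite dp.
apply/idP/orP => [exy|[/andP[xo /eqP ->]|/andP[yo /eqP ->]]].
- have [dyx|dxy] := leqP (d y) (d x); first by left; apply: up.
  by right; apply: up (ltnW dxy); rewrite sym.
- by have [] := dist_parentP xo.
- by rewrite sym; have [] := dist_parentP yo.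
Qed.

Hypothesis e_regular : regular e 3.

Lemma finite_ball n : finite_set [set x | d x <= n]%classic.
Proof.
elim: n => [|n IH].
  apply: (@sub_finite_set _ _ [set o]%classic); last exact: finite_set1.
  by move=> x /=; rewrite leqn0 dist_eq0 => /eqP.
pose nb x : set T := [set y | e x y]%classic.
apply: (@sub_finite_set _ _ ([set o] `|` \bigcup_(x in [set x | d x <= n]) nb x)%classic).
  move=> x /= dx; have [->|xo] := eqVneq x o; first by left.
  right; have [ep dp] := dist_parentP xo; exists (dist_parent x) => /=.
    by rewrite -ltnS -dp.
  by have [sym _ _ _] := e_tree; rewrite /nb /= sym.
rewrite finite_setU; split; first exact: finite_set1.
apply: bigcup_finite => // x _; have [s [_ _ sE]] := e_regular x.
apply: (@sub_finite_set _ _ [set` s]%classic); last exact: finite_seq.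
by move=> y /=; rewrite /nb /= sE.
Qed.

Lemma in_ball n x : (x \in ball e o n) = (d x <= n).
Proof.
rewrite /ball in_fset_set; last exact: finite_ball.
by apply/idP/idP; rewrite inE.
Qed.
End TreeDistance.

(** * Balls of the homogeneous tree of degree three *)

(** All that the estimates use of the ball of radius l. The degree is prescribed
below level l only, since the vertices of level l lose their children to the
complement of the ball. *)
Definition ternary_ball (V : finType) (e : rel V) (o : V) (p : V -> V)
    (h : V -> nat) (l : nat) : Prop :=
  [/\ rooted e o p h, h o = 0, forall x, x != o -> h x = (h (p x)).+1,
      forall x, h x <= l & forall x, h x < l -> deg e x = 3].

Lemma G1_ternary_ball (T : choiceType) (e : rel T) (o : T) (l : nat) :
    homogeneous_tree e 3 ->
  exists r p, ternary_ball (@G1_adj T e o l) r p (@level T e o l) l.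
Proof.
move=> [tree reg].
have [sym _ _ _] := tree.
have inB x := in_ball o tree reg l x.
have oB : o \in ball e o l by rewrite inB dist_root.
pose r : G1_vertex e o l := [` oB]%fset.
pose p (x : G1_vertex e o l) : G1_vertex e o l := insubd x (dist_parent e o (val x)).
have [adj desc] := dist_rooted o tree.
have xr (x : G1_vertex e o l) : (x != r) = (val x != o) by rewrite -val_eqE.
have le_l (x : G1_vertex e o l) : level x <= l by rewrite /level -inB (valP x).
have pE x : x != r -> val (p x) = dist_parent e o (val x).
  rewrite xr => xo; rewrite insubdK // -topredE /= inB.
  by rewrite (leq_trans (ltnW (desc _ xo))) // -inB (valP x).
exists r, p; split=> //.
- split=> [x y|x xo].
    rewrite /G1_adj adj -!xr; congr (_ || _); apply: andb_id2l => xo.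
      by rewrite -pE // val_eqE.
    by rewrite -pE // val_eqE.
  by rewrite /level pE // desc // -xr.
- exact: dist_root.
- by move=> x xo; rewrite /level pE //; have [] := dist_parentP tree (_ : val x != o); rewrite -?xr.
move=> x xl; have [s [us <- sE]] := reg (val x).
rewrite /deg cardE -(size_map val); apply/perm_size/uniq_perm => //.
  by rewrite (map_inj_uniq val_inj) enum_uniq.
move=> y; rewrite sE; apply/mapP/idP => [[z + ->]|exy]; first by rewrite mem_enum inE.
have yB : y \in ball e o l.
  by rewrite inB (leq_trans (dist_step o tree exy)).
by exists [` yB]%fset => //; rewrite mem_enum inE.
Qed.

Section Counting.
Variables (V : finType) (e : rel V) (o : V) (p : V -> V) (h : V -> nat) (l : nat).
Hypothesis ball_e : ternary_ball e o p h l.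

Lemma level_eq0 x : (h x == 0) = (x == o).
Proof.
have [_ ho hp _ _] := ball_e.
by have [->|/hp ->] := eqVneq x o; rewrite ?ho.
Qed.

Lemma card_children x : #|children o p x| =
  if h x == l then 0 else if x == o then 3 else 2.
Proof.
have [rt ho hp hl d3] := ball_e.
have [hx|hx] := eqVneq (h x) l.
  apply: eq_card0 => y; rewrite !inE; apply/negP => /andP[/hp hy /eqP py].
  by have := hl y; rewrite hy py hx ltnn.
have := rooted_deg x rt; rewrite d3; last by rewrite ltn_neqAle hx hl.
by case: (eqVneq x o) => _ /=; lia.
Qed.

Lemma deg_ball x : 0 < l -> deg e x = if h x == l then 1 else 3.
Proof.
have [rt ho hp hl d3] := ball_e => l0.
have [hx|hx] := eqVneq (h x) l; last by rewrite d3 // ltn_neqAle hx hl.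
by rewrite (rooted_deg x rt) card_children hx eqxx addn0 -level_eq0 hx -lt0n l0.
Qed.

Lemma bdry_ball : 0 < l -> bdry e = [set x | h x == l].
Proof.
by move=> l0; apply/setP => x; rewrite !inE deg_ball //; case: (_ == l).
Qed.

(** A vertex of level 0 < j < l has two children. This doubling is what makes
long paths cheap: it drives all the counts and sums over levels. *)
Lemma sum_level_step (R : nmodType) j (g : V -> R) : 0 < j < l ->
  (\sum_(y | h y == j.+1) g (p y) = (\sum_(x | h x == j) g x) *+ 2)%R.
Proof.
have [_ ho hp _ _] := ball_e => /andP[j0 jl].
rewrite (partition_big p (fun x => h x == j)) /=; last first.
  move=> y hy; have yo : y != o by rewrite -level_eq0 (eqP hy).
  by rewrite -eqSS -hp.
rewrite -sumrMnl; apply: eq_bigr => x /eqP hx.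
rewrite (eq_bigr (fun=> g x)); last by move=> y /andP[_ /eqP ->].
rewrite sumr_const; congr (_ *+ _)%R.
have -> : 2 = #|children o p x|.
  by rewrite card_children hx ltn_eqF // -level_eq0 hx gtn_eqF.
apply: eq_card => y; rewrite unfold_in [RHS]inE /=; have [->|yo] := eqVneq y o.
  by rewrite ho.
rewrite hp // eqSS; apply: andb_idl => /eqP ->; exact/eqP.
Qed.

Lemma card_level j : 0 < j <= l -> #|[set x | h x == j]| = 3 * 2 ^ j.-1.
Proof.
have [_ ho hp _ _] := ball_e.
elim: j => // -[_ l0|j IH jl].
  rewrite muln1.
  have -> : 3 = #|children o p o|.
    by rewrite card_children ho eqxx ltn_eqF.
  apply: eq_card => x; rewrite inE [RHS]inE; have [->|xo] := eqVneq x o.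
    by rewrite ho.
  by rewrite hp // eqSS level_eq0.
have jl' : 0 < j.+1 < l by lia.
have E : \sum_(y | h y == j.+2) 1 =
    \sum_(x | h x == j.+1) 1 + \sum_(x | h x == j.+1) 1.
  exact: (@sum_level_step nat _ (fun=> 1) jl').
move: E; rewrite !sum1dep_card IH //=; last by lia.
by rewrite expnS; lia.
Qed.

Lemma sum_by_level (f : nat -> nat) :
  \sum_(y | y != o) f (h y) = \sum_(0 <= k < l) 3 * 2 ^ k * f k.+1.
Proof.
have [_ ho hp hl _] := ball_e.
transitivity (\sum_(k < l) \sum_(y | h y == k.+1) f (h y)); last first.
  rewrite big_mkord; apply: eq_bigr => k _.
  rewrite (eq_bigr (fun=> f k.+1)); last by move=> y /eqP ->.
  rewrite sum_nat_const -cardsE card_level //.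
  by rewrite /= ltn_ord.
rewrite (exchange_big_dep (fun y => y != o)) /=; last first.
  by move=> k y _; rewrite -level_eq0 => /eqP ->.
apply: eq_bigr => y yo; have hy := hp y yo.
have hpy : h (p y) < l by rewrite -hy hl.
rewrite (big_pred1 (Ordinal hpy)) // => k.
by rewrite hy eqSS eq_sym.
Qed.

Lemma card_ball : #|V| = (\sum_(0 <= k < l) 3 * 2 ^ k).+1.
Proof.
rewrite -[LHS]sum1_card (bigD1 o) //= (sum_by_level (fun=> 1)) add1n.
by congr _.+1; apply: eq_bigr => k _; rewrite muln1.
Qed.

End Counting.

(** * Refinement of a rooted tree *)

Section RefinedTree.
Variables (V : finType) (e : rel V) (o : V) (p : V -> V) (h : V -> nat).
Hypothesis e_rooted : rooted e o p h.
Hypothesis h_parent : forall x, x != o -> h x = (h (p x)).+1.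

Local Notation W := (refined_vertex e h).
Local Notation added := (added e h).
Local Notation upward := (upward e h).
Local Notation root := (inl o : W).

(** The i-th vertex of the path replacing the edge a. For i = (added a).+1 the
insertion fails and the value is the upper endpoint of a. *)
Definition node (a : V * V) (i : nat) : W :=
  if i is i'.+1 then
    if insub i' is Some j then inr (Tagged (fun a => 'I_(added a)) (j : 'I_(added a)))
    else inl a.2
  else inl a.1.

(** A vertex w other than the root is the vertex number (index_of w).+1 of the
path replacing edge_of w, and its parent is the preceding vertex. *)
Definition edge_of (w : W) : V * V :=
  match w with inl y => (p y, y) | inr v => tag v end.

Definition index_of (w : W) : nat :=
  match w with inl y => added (p y, y) | inr v => tagged v end.

Definition refined_parent (w : W) : W := node (edge_of w) (index_of w).

(** The distance from the root to the vertices of level n in the refined tree,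
the edge between the levels k and k.+1 being replaced by a path of length
k.+1. *)
Definition height0 n := \sum_(k < n) k.+1.

Definition refined_height (w : W) : nat :=
  match w with
  | inl x => height0 (h x)
  | inr v => height0 (h (tag v).1) + (tagged v).+1
  end.

Lemma upwardE a : upward a = (a.2 != o) && (a.1 == p a.2).
Proof.
have [adj _] := e_rooted.
rewrite /upward adj; apply/andP/andP => [[/orP[/andP[ao /eqP ->]|/andP[-> ->] //]]|].
  by rewrite (h_parent ao) => /eqP; lia.
by move=> [ao /eqP ap]; rewrite ap ao !eqxx orbT h_parent.
Qed.

Lemma upwardP a : upward a -> a = (p a.2, a.2).
Proof. by case: a => x y; rewrite upwardE => /andP[_ /eqP /= ->]. Qed.

Lemma added_parent y : y != o -> (added (p y, y)).+1 = h y.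
Proof. by move=> yo; rewrite /added upwardE /= yo eqxx -h_parent. Qed.

Lemma node_edge w : node (edge_of w) (index_of w).+1 = w.
Proof.
case: w => [y|[a i]] /=; first by rewrite insubF // ltnn.
by rewrite insubT //= => lt; congr (inr (Tagged _ _)); apply: val_inj.
Qed.

Lemma ltn_added a i : i < added a -> upward a.
Proof. by rewrite /added; case: ifP. Qed.

Lemma edge_upward w : w != root ->
  upward (edge_of w) /\ index_of w <= added (edge_of w).
Proof.
case: w => [y|[a i]] /= wo.
  by rewrite upwardE /= eqxx andbT.
by split; [exact: ltn_added (ltn_ord i)|exact: ltnW].
Qed.

Lemma node_last a : node a (added a).+1 = inl a.2.
Proof. by rewrite /= insubF // ltnn. Qed.

Lemma edge_node a i : upward a -> i <= added a ->
  [/\ edge_of (node a i.+1) = a, index_of (node a i.+1) = i & node a i.+1 != root].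
Proof.
move=> ua; rewrite leq_eqVlt => /orP[/eqP ->|ia].
  rewrite node_last /= -upwardP //; split=> //.
  by have := ua; rewrite upwardE => /andP[].
by rewrite /= insubT.
Qed.

Lemma positionP a w i : upward a ->
  position a w = Some i <-> i <= (added a).+1 /\ w = node a i.
Proof.
move=> ua; have a12 : a.2 != a.1.
  apply/eqP => a21; have [_ desc] := e_rooted.
  have := ua; rewrite upwardE => /andP[/desc + /eqP pa].
  by rewrite -pa a21 ltnn.
split.
  case: w => [x|[b j]] /=.
    by case: eqVneq => [-> [<-]//|_]; case: eqVneq => // -> [<-]; rewrite node_last.
  case: eqVneq => // ba [<-]; subst b; split; first by rewrite ltnS ltnW.
  by rewrite /= insubT //= => lt; congr (inr (Tagged _ _)); apply: val_inj.
move=> [ia ->]; case: i ia => [_|i]; first by rewrite /= eqxx.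
rewrite ltnS leq_eqVlt => /orP[/eqP ->|ia].
  by rewrite node_last /= (negPf a12) eqxx.
by rewrite /= insubT /= eqxx.
Qed.

Lemma refined_adjP u v : reflect
  (exists a i, [/\ upward a, i <= added a &
    (u = node a i /\ v = node a i.+1) \/ (v = node a i /\ u = node a i.+1)])
  (@refined_adj V e h u v).
Proof.
apply: (iffP existsP) => [[a /andP[ua]]|[a [i [ua ia uv]]]].
  case pu: (position a u) => [i|//]; case pv: (position a v) => [j|//].
  have [iu ->] := (positionP u i ua).1 pu; have [jv ->] := (positionP v j ua).1 pv.
  by case/orP => /eqP ij; subst; [exists a, j|exists a, i]; split=> //; auto.
have pi : position a (node a i) = Some i by apply/positionP => //; split=> //; apply: leqW.
have pS : position a (node a i.+1) = Some i.+1 by apply/positionP.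
by exists a; rewrite ua; case: uv => -[-> ->]; rewrite pi pS eqxx ?orbT.
Qed.

Lemma height0S n : height0 n.+1 = height0 n + n.+1.
Proof. by rewrite /height0 big_ord_recr. Qed.

Lemma refined_height_node a i : upward a -> i <= (added a).+1 ->
  refined_height (node a i) = height0 (h a.1) + i.
Proof.
move=> ua; case: i => [|i]; first by rewrite addn0.
rewrite ltnS leq_eqVlt => /orP[/eqP ->|ia]; last by rewrite /= insubT.
rewrite node_last /=; have := ua; rewrite upwardE => /andP[ao /eqP pa].
by rewrite (h_parent ao) height0S -pa /added ua.
Qed.

Lemma refined_rooted :
  rooted (@refined_adj V e h) root refined_parent refined_height.
Proof.
split=> [u v|w wo]; last first.
  have [ua ia] := edge_upward wo.
  rewrite -{2}(node_edge w) /refined_parent !refined_height_node //; first lia.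
  exact: leqW.
apply/refined_adjP/orP => [[a [i [ua ia uv]]]|uv].
  have [ea ea' nr] := edge_node ua ia.
  case: uv => -[-> ->]; [right|left]; by rewrite nr /refined_parent ea ea' eqxx.
case: uv => /andP[wo /eqP ->]; have [ua ia] := edge_upward wo.
  exists (edge_of u), (index_of u); split=> //; right; split=> //.
  by rewrite node_edge.
exists (edge_of v), (index_of v); split=> //; left; split=> //.
by rewrite node_edge.
Qed.

(** Refining leaves the number of children unchanged at the original vertices:
each child is replaced by the first vertex of the path leading to it. *)
Lemma children_inl x : children root refined_parent (inl x) =
  [set node (p y, y) 1 | y in children o p x].
Proof.
apply/setP => w; rewrite inE; apply/andP/imsetP => [[wo /eqP pw]|[y + ->]].
  have [ua ia] := edge_upward wo; move: pw; rewrite /refined_parent.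
  case iw: (index_of w) ia => [|i] ia /=; last by rewrite insubT.
  move=> [a1]; exists (edge_of w).2; last first.
    by have := node_edge w; rewrite iw {1}(upwardP ua).
  by move: ua; rewrite upwardE inE -a1 [_ == p _]eq_sym.
rewrite inE => /andP[yo /eqP py].
have ua : upward (p y, y) by rewrite upwardE yo eqxx.
have [ea ia nr] := edge_node ua (leq0n _).
by rewrite nr /refined_parent ea ia /= py eqxx.
Qed.

Lemma children_inr v : children root refined_parent (inr v) =
  [set node (tag v) (tagged v).+2].
Proof.
have ua := ltn_added (ltn_ord (tagged v)).
have [ea ia nr] := edge_node ua (ltn_ord (tagged v)).
apply/setP => w; rewrite /children !inE; apply/andP/eqP => [[wo /eqP pw]|->]; last first.
  rewrite nr /refined_parent ea ia /= insubT //= => lt; split=> //.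
  by apply/eqP; case: (v) lt => a i /= lt; congr (inr (Tagged _ _)); apply: val_inj.
have [uw iw] := edge_upward wo; move: pw; rewrite /refined_parent.
case ei: (index_of w) iw => [//|i] iw /=; rewrite insubT => -[vE].
by rewrite -vE -[in LHS](node_edge w) ei.
Qed.

Lemma deg_refined w : deg (@refined_adj V e h) w = if w is inl x then deg e x else 2.
Proof.
rewrite (rooted_deg _ refined_rooted); case: w => [x|v]; last first.
  by rewrite children_inr cards1.
rewrite children_inl (rooted_deg _ e_rooted) card_in_imset //.
move=> y z; rewrite !inE => /andP[yo _] /andP[zo _] yz.
have uy : upward (p y, y) by rewrite upwardE yo eqxx.
have uz : upward (p z, z) by rewrite upwardE zo eqxx.
have [+ _ _] := edge_node uy (leq0n _).
by rewrite yz; have [-> _ _] := edge_node uz (leq0n _) => -[].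
Qed.

(** The vertices other than the root stand for the edges of the refined tree,
grouped here along the paths of the refinement. *)
Lemma sum_refined (R : nmodType) (F : W -> R) :
  (\sum_(w | w != root) F w =
   \sum_(y | y != o) \sum_(i < h y) F (node (p y, y) i.+1))%R.
Proof.
rewrite (partition_big (fun w => (edge_of w).2) (fun y => y != o)); last first.
  by move=> w /edge_upward[]; rewrite upwardE => /andP[].
apply: eq_bigr => y yo.
have uy : upward (p y, y) by rewrite upwardE yo eqxx.
have hy0 : 0 < h y by rewrite h_parent.
rewrite (reindex_onto (fun i : 'I_(h y) => node (p y, y) i.+1)
  (fun w => insubd (Ordinal hy0) (index_of w))); last first.
  move=> w /andP[/edge_upward[uw iw] /eqP ey].
  have ew : edge_of w = (p y, y) by rewrite (upwardP uw) ey.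
  have iy : index_of w < h y by rewrite -added_parent // ltnS -ew.
  by rewrite val_insubd iy -ew node_edge.
apply: eq_bigl => i.
have iy : i <= added (p y, y) by rewrite -ltnS added_parent.
have [-> -> ->] := edge_node uy iy; rewrite eqxx /=.
by apply/eqP/val_inj; rewrite val_insubd ltn_ord.
Qed.

Lemma card_refined : #|W| = #|V| + \sum_(y | y != o) (h y).-1.
Proof.
have E : \sum_(w : W | w != root) 1 = \sum_(y | y != o) \sum_(i < h y) 1.
  exact: (@sum_refined nat (fun=> 1)).
rewrite -[#|W|]sum1_card -[#|V|]sum1_card (bigD1 root) //= E.
rewrite [in RHS](bigD1 o) //= -addnA -big_split; congr (_ + _).
apply: eq_bigr => y yo; rewrite sum1_card card_ord.
by rewrite (h_parent yo).
Qed.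

End RefinedTree.

(** * The second eigenvalue of a real symmetric matrix *)

Local Open Scope ring_scope.

Section SymmetricSpectrum.
Local Open Scope sesquilinear_scope.

Lemma hermitian_unitary_diag (C : numClosedFieldType) n (A : 'M[C]_n) :
    A^T = A -> A \is a mxOver Num.real ->
  exists (d : 'rV[C]_n) (P : 'M[C]_n), [/\ P \is unitarymx,
    d \is a mxOver Num.real & A = P^t Num.conj *m diag_mx d *m P].
Proof.
move=> sA rA; have hA : A \is hermsymmx.
  apply: realsym_hermsym => //.
  by apply/is_hermitianmxP; rewrite expr0 scale1r map_mx_id.
exists (spectral_diag A), (spectralmx A).
split; [exact: spectral_unitarymx|exact: hermitian_spectral_diag_real|].
rewrite -invmx_unitary ?spectral_unitarymx //.
exact/orthomx_spectralP/hermitian_normalmx.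
Qed.

Variables (R : realType) (n : nat).
Implicit Types (A B : 'M[R]_n).
Local Notation C := (complex R).
Local Notation toC := (map_mx (real_complex R)).

Definition qform m (B : 'M[R]_m) (x : 'rV[R]_m) : R := \sum_i \sum_j x 0 i * B i j * x 0 j.

Lemma symmetric_unitary_diag A : A^T = A -> exists (d : 'rV[R]_n) (P : 'M[C]_n),
  P \is unitarymx /\ toC A = P^t* *m diag_mx (toC d) *m P.
Proof.
move=> symA.
have rA : toC A \is a realmx.
  by apply/mxOverP => i j; rewrite mxE complex_real.
have sA : (toC A)^T = toC A by rewrite map_trmx symA.
have [d [P [uP /mxOverP rd eA]]] := hermitian_unitary_diag sA rA.
exists (\row_i complex.Re (d 0 i)), P; split; first exact: uP.
suff -> : toC (\row_i complex.Re (d 0 i)) = d by [].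
by apply/rowP => i; rewrite !mxE RRe_real.
Qed.

Definition re_row m (w : 'rV[C]_m) : 'rV[R]_m := \row_i complex.Re (w 0 i).
Definition im_row m (w : 'rV[C]_m) : 'rV[R]_m := \row_i complex.Im (w 0 i).
Definition sqnorm (z : C) : R := complex.Re z ^+ 2 + complex.Im z ^+ 2.

Lemma sqnorm_ge0 z : 0 <= sqnorm z.
Proof. by rewrite addr_ge0 ?sqr_ge0. Qed.

Lemma sqnorm_eq0 z : (sqnorm z == 0) = (z == 0).
Proof. by case: z => a b; rewrite /sqnorm paddr_eq0 ?sqr_ge0 // !sqrf_eq0 eq_complex. Qed.

Lemma Re_sum (I : Type) (r : seq I) (P : pred I) (F : I -> C) :
  complex.Re (\sum_(i <- r | P i) F i) = \sum_(i <- r | P i) complex.Re (F i).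
Proof. by apply: (big_morph (@complex.Re R)) => // -[a b] [c d]. Qed.

Lemma Re_hermitian_form B (w : 'rV[C]_n) :
  complex.Re ((w *m toC B *m w^t*) 0 0) = qform B (re_row w) + qform B (im_row w).
Proof.
rewrite /qform mxE Re_sum /= exchange_big /=.
rewrite [X in _ = _ + X]exchange_big -big_split; apply: eq_bigr => j _ /=.
rewrite !mxE mulr_suml Re_sum -big_split; apply: eq_bigr => i _ /=.
rewrite !mxE; case: (w 0 i) (w 0 j) => a b [a' b'] /=.
by ring.
Qed.

Lemma Im_sum (I : Type) (r : seq I) (P : pred I) (F : I -> C) :
  complex.Im (\sum_(i <- r | P i) F i) = \sum_(i <- r | P i) complex.Im (F i).
Proof. by apply: (big_morph (@complex.Im R)) => // -[a b] [c d]. Qed.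

(** The diagonalisation lives over the complex numbers, while the bounds at hand
concern real vectors. A Hermitian form with real coefficients is the sum of
its values at the real and imaginary parts, which bridges the two. *)
Lemma qform_diag B (d : 'rV[R]_n) (P : 'M[C]_n) (y : 'rV[C]_n) :
    P \is unitarymx -> toC B = P^t* *m diag_mx (toC d) *m P ->
  qform B (re_row (y *m P)) + qform B (im_row (y *m P)) = \sum_i d 0 i * sqnorm (y 0 i).
Proof.
move=> uP eB; rewrite -Re_hermitian_form eB.
have PP : P *m P^t* = 1%:M by apply/unitarymxP.
have -> : y *m P *m (P^t* *m diag_mx (toC d) *m P) *m (y *m P)^t*
    = y *m diag_mx (toC d) *m y^t*.
  rewrite trmx_mul map_mxM !mulmxA -(mulmxA y) PP mulmx1.
  by rewrite -(mulmxA _ P) PP mulmx1.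
rewrite mul_mx_diag mxE Re_sum; apply: eq_bigr => i _; rewrite !mxE /sqnorm.
by case: (y 0 i) => a b /=; ring.
Qed.

Lemma char_poly_conjugate (S : comNzRingType) m (P Q D : 'M[S]_m) :
  Q *m P = 1%:M -> char_poly (Q *m D *m P) = char_poly D.
Proof.
move=> QP.
have mapQP : map_mx (@polyC S) Q *m map_mx (@polyC S) P = 1%:M.
  by rewrite -map_mxM QP map_mx1.
rewrite /char_poly.
have -> : char_poly_mx (Q *m D *m P) =
    map_mx (@polyC S) Q *m char_poly_mx D *m map_mx (@polyC S) P.
  rewrite /char_poly_mx mulmxBr mulmxBl !map_mxM; congr (_ - _).
  by rewrite -scalemx1 -scalemxAr mulmx1 -scalemxAl mapQP.
by rewrite !det_mulmx mulrAC -det_mulmx mapQP det1 mul1r.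
Qed.

(** A real symmetric matrix has a characteristic polynomial that splits over the
reals, with the entries of its diagonalisation as roots. *)
Lemma char_poly_symmetric A (d : 'rV[R]_n) (P : 'M[C]_n) :
    P \is unitarymx -> toC A = P^t* *m diag_mx (toC d) *m P ->
  char_poly A = \prod_i ('X - (d 0 i)%:P).
Proof.
move=> uP eA.
apply: (map_inj_poly (f := real_complex R)) => //; first exact: complexI.
rewrite map_char_poly eA char_poly_conjugate; last first.
  by rewrite -invmx_unitary // mulVmx // unitarymx_unit.
rewrite char_poly_trig ?diag_mx_is_trig // rmorph_prod; apply: eq_bigr => i _.
by rewrite !mxE eqxx mulr1n rmorphB /= map_polyX map_polyC.
Qed.

Lemma spectrum_diag A (d : 'rV[R]_n) s :
    char_poly A = \prod_i ('X - (d 0 i)%:P) -> is_spectrum A s ->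
  perm_eq s [seq d 0 i | i : 'I_n].
Proof.
move=> eA [_ eAs]; apply: prod_XsubC_eq.
by rewrite -eAs eA big_map big_enum.
Qed.

Lemma symmetric_spectrum_exists A : A^T = A -> exists s, is_spectrum A s.
Proof.
move=> /symmetric_unitary_diag [d [P [uP eA]]].
exists (sort <=%R [seq d 0 i | i : 'I_n]); split.
  exact/sort_sorted/le_total.
rewrite (char_poly_symmetric uP eA).
rewrite (perm_big [seq d 0 i | i : 'I_n]) ?big_map ?big_enum //.
by rewrite perm_sort.
Qed.

Lemma qform_scalar (x : 'rV[R]_n) : qform 1%:M x = \sum_i x 0 i ^+ 2.
Proof.
apply: eq_bigr => i _; rewrite (bigD1 i) //= mxE eqxx mulr1 -expr2 big1 ?addr0 //.
by move=> j ji; rewrite mxE eq_sym (negPf ji) mulr0 mul0r.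
Qed.

Lemma sqnorm_unitary (P : 'M[C]_n) (y : 'rV[C]_n) : P \is unitarymx ->
  \sum_i re_row (y *m P) 0 i ^+ 2 + \sum_i im_row (y *m P) 0 i ^+ 2 =
  \sum_i sqnorm (y 0 i).
Proof.
move=> uP; rewrite -!qform_scalar (@qform_diag _ (const_mx 1) P) //.
  by apply: eq_bigr => i _; rewrite mxE mul1r.
rewrite map_mx1 map_const_mx rmorph1.
have -> : diag_mx (const_mx 1) = 1%:M :> 'M[C]_n.
  by apply/matrixP => i j; rewrite !mxE.
by rewrite mulmx1 -invmx_unitary // mulVmx // unitarymx_unit.
Qed.

(** Two numbers are linearly dependent: this selects, in a plane, a nonzero vector
on which a given linear form vanishes. *)
Lemma linear_relation (p q : C) :
  exists a b : C, ((a != 0) || (b != 0)) /\ a * p + b * q = 0.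
Proof.
have [->|p0] := eqVneq p 0; first by exists 1, 0; rewrite oner_neq0 mulr0 mul0r addr0.
by exists q, (- p); rewrite oppr_eq0 p0 orbT mulrC mulNr subrr.
Qed.

Lemma spectrum_size A s : is_spectrum A s -> size s = n.
Proof.
move=> [_ eA]; apply: succn_inj.
by rewrite -(size_char_poly A) eA size_prod_XsubC.
Qed.

Lemma count_spectrum (Q : pred R) (d : 'rV[R]_n) s :
  perm_eq s [seq d 0 i | i : 'I_n] -> count Q s = #|[pred i | Q (d 0 i)]|.
Proof. by move=> /permP ->; rewrite count_map -sum1_count big_enum_cond -sum1_card. Qed.

Lemma sum_le0_eq0 (F : 'I_n -> R) :
  (forall k, 0 <= F k) -> \sum_k F k <= 0 -> forall k, F k = 0.
Proof.
move=> F0 sF k; apply: (psumr_eq0P (P := predT)) => //.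
by apply/le_anti; rewrite sF sumr_ge0.
Qed.

(** One half of the Courant-Fischer principle. If two eigenvalues were below mu,
the plane spanned by their eigenvectors would contain a nonzero vector
orthogonal to v, where the form would be less than mu times the squared
norm. *)
Lemma le_second_eigenvalue A (v : 'rV[R]_n) s (mu : R) :
    A^T = A -> is_spectrum A s -> (1 < n)%N ->
    (forall x : 'rV[R]_n, \sum_i x 0 i * v 0 i = 0 ->
       mu * (\sum_i x 0 i ^+ 2) <= qform A x) ->
  mu <= s`_1.
Proof.
move=> symA sA n1 pos; have [d [P [uP eA]]] := symmetric_unitary_diag symA.
rewrite leNgt; apply/negP => s1.
have ds := spectrum_diag (char_poly_symmetric uP eA) sA.
have : (1 < count (< mu) s)%N.
  have := spectrum_size sA; case: sA => + _; case: s s1 {ds} => [|a [|b t]] /=.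
  - by move=> _ _ n0; rewrite -n0 in n1.
  - by move=> _ _ n0; rewrite -n0 in n1.
  by move=> bm /andP[ab _] _; rewrite bm (le_lt_trans ab bm).
rewrite (count_spectrum _ ds) => /card_gt1P[i [j [dim djm ij]]].
(* y holds the coordinates in the eigenbasis of a vector orthogonal to v *)
have [a [b [ab0 ab]]] := linear_relation (\sum_k P i k * (v 0 k)%:C%C)
  (\sum_k P j k * (v 0 k)%:C%C).
pose y : 'rV[C]_n := a *: delta_mx 0 i + b *: delta_mx 0 j.
have yE k : y 0 k = a * (k == i)%:R + b * (k == j)%:R by rewrite !mxE.
have yP k : (y *m P) 0 k = a * P i k + b * P j k.
  by rewrite mulmxDl -!scalemxAl -!rowE !mxE.
have wv : \sum_k (y *m P) 0 k * (v 0 k)%:C%C = 0.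
  rewrite -[RHS]ab !mulr_sumr -big_split; apply: eq_bigr => k _.
  by rewrite yP mulrDl !mulrA.
have rew : \sum_k re_row (y *m P) 0 k * v 0 k = 0.
  rewrite -[RHS](congr1 (@complex.Re R) wv) Re_sum; apply: eq_bigr => k _.
  by rewrite mxE; case: ((y *m P) 0 k) => e f /=; rewrite mulr0 subr0.
have imw : \sum_k im_row (y *m P) 0 k * v 0 k = 0.
  rewrite -[RHS](congr1 (@complex.Im R) wv) Im_sum; apply: eq_bigr => k _.
  by rewrite mxE; case: ((y *m P) 0 k) => e f /=; rewrite mulr0 add0r.
have := lerD (pos _ rew) (pos _ imw).
rewrite -mulrDr sqnorm_unitary // (qform_diag _ uP eA) mulr_sumr -subr_le0 -sumrB.
under eq_bigr do rewrite -mulrBl.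
move=> /sum_le0_eq0 terms0.
have {}terms0 k : (mu - d 0 k) * sqnorm (y 0 k) = 0.
  apply: terms0 => {}k; have [kij|] := boolP ((k == i) || (k == j)).
    apply: mulr_ge0 (sqnorm_ge0 _); rewrite subr_ge0 ltW //.
    by case/orP: kij => /eqP ->.
  rewrite negb_or yE => /andP[/negPf -> /negPf ->].
  by rewrite !mulr0 addr0 (eqP (_ : sqnorm 0 == 0)) ?sqnorm_eq0 // mulr0.
have y0 k : d 0 k < mu -> y 0 k = 0.
  move=> dk; apply/eqP; rewrite -sqnorm_eq0; have/eqP := terms0 k.
  by rewrite mulf_eq0 subr_eq0 gt_eqF.
move: (y0 i dim) (y0 j djm) ab0; rewrite !yE !eqxx (eq_sym j) (negPf ij).
by rewrite !mulr0 !mulr1 addr0 add0r => -> ->; rewrite eqxx.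
Qed.

(** The other half of the Courant-Fischer principle. If all the eigenvalues but
one exceeded mu, the plane spanned by u and v would contain a nonzero vector
without component along the exceptional eigenvector, where the form would
exceed mu times the squared norm. *)
Lemma second_eigenvalue_le A (u v : 'rV[R]_n) s (mu : R) :
    A^T = A -> is_spectrum A s -> (1 < n)%N ->
    (forall a b : R, a *: u + b *: v = 0 -> a = 0 /\ b = 0) ->
    (forall a b : R, let x := a *: u + b *: v in
       qform A x <= mu * (\sum_i x 0 i ^+ 2)) ->
  s`_1 <= mu.
Proof.
move=> symA sA n1 free neg; have [d [P [uP eA]]] := symmetric_unitary_diag symA.
rewrite leNgt; apply/negP => s1.
have ds := spectrum_diag (char_poly_symmetric uP eA) sA.
have : (count (<= mu) s <= 1)%N.
  have := spectrum_size sA; case: sA => + _; case: s s1 {ds} => [|a [|b t]] /=.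
  - by move=> _ _ n0; rewrite -n0 in n1.
  - by move=> _ _ n0; rewrite -n0 in n1.
  move=> bm /andP[ab abt] _; rewrite [b <= mu]leNgt bm add0n.
  suff -> : count (<= mu) t = 0%N by rewrite addn0; case: (_ <= _).
  apply/eqP; rewrite -leqn0 leqNgt -has_count; apply/hasPn => c ct /=.
  by rewrite -ltNge (lt_le_trans bm) //; move/order_path_min: abt => /(_ le_trans)/allP; apply.
rewrite (count_spectrum _ ds) => few.
have [i0 gt_mu] : exists i0, forall i, i != i0 -> mu < d 0 i.
  have [i0 i0P|none] := pickP [pred i | d 0 i <= mu].
    exists i0 => i ii0; rewrite ltNge; apply/negP => di.
    move: few; rewrite leqNgt => /negP; apply; apply/card_gt1P.
    by exists i, i0.
  by exists (Ordinal (ltnW n1)) => i _; have := none i; rewrite /= ltNge => ->.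
(* w lies in the plane and its eigencoordinate number i0 vanishes *)
have [a [b [ab0 ab]]] := linear_relation ((toC u *m P^t* ) 0 i0) ((toC v *m P^t* ) 0 i0).
pose w : 'rV[C]_n := a *: toC u + b *: toC v.
pose y : 'rV[C]_n := w *m P^t*.
have yw : y *m P = w.
  by rewrite -mulmxA -invmx_unitary // mulVmx ?mulmx1 // unitarymx_unit.
have yi0 : y 0 i0 = 0.
  by rewrite -[RHS]ab /y /w mulmxDl -!scalemxAl mxE [X in X + _]mxE [X in _ + X]mxE.
have rew : re_row w = complex.Re a *: u + complex.Re b *: v.
  by apply/rowP => k; rewrite !mxE; case: (a) (b) => a1 a2 [b1 b2] /=; ring.
have imw : im_row w = complex.Im a *: u + complex.Im b *: v.
  by apply/rowP => k; rewrite !mxE; case: (a) (b) => a1 a2 [b1 b2] /=; ring.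
have := lerD (neg (complex.Re a) (complex.Re b)) (neg (complex.Im a) (complex.Im b)).
rewrite /= -rew -imw -mulrDr -yw sqnorm_unitary // (qform_diag _ uP eA).
rewrite mulr_sumr -subr_le0 -sumrB.
under eq_bigr do rewrite -mulrBl.
move=> /sum_le0_eq0 terms0.
have {}terms0 k : (d 0 k - mu) * sqnorm (y 0 k) = 0.
  apply: terms0 => {}k; have [->|ki] := eqVneq k i0.
    by rewrite yi0 (eqP (_ : sqnorm 0 == 0)) ?sqnorm_eq0 // mulr0.
  by rewrite mulr_ge0 ?sqnorm_ge0 // subr_ge0 ltW // gt_mu.
have y0 : y = 0.
  apply/rowP => k; rewrite [RHS]mxE; have [->//|ki] := eqVneq k i0.
  apply/eqP; rewrite -sqnorm_eq0; have/eqP := terms0 k.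
  by rewrite mulf_eq0 subr_eq0 gt_eqF // gt_mu.
have w0 : w = 0 by rewrite -yw y0 mul0mx.
have [Rea Reb] : complex.Re a = 0 /\ complex.Re b = 0.
  by apply: free; rewrite -rew w0; apply/rowP => k; rewrite !mxE.
have [Ima Imb] : complex.Im a = 0 /\ complex.Im b = 0.
  by apply: free; rewrite -imw w0; apply/rowP => k; rewrite !mxE.
by move: ab0; rewrite !eq_complex Rea Reb Ima Imb eqxx.
Qed.
End SymmetricSpectrum.

(** * Variational bounds for the first Steklov eigenvalue *)

Section SteklovVariational.
Variables (R : realType) (V : finType) (e : rel V).
Implicit Types (u v : {ffun V -> R}).

Definition dirichlet u v : R :=
  2^-1 * \sum_x \sum_(y | e x y) (u x - u y) * (v x - v y).

Lemma dirichletE u : dirichlet u u = 2^-1 * \sum_x \sum_(y | e x y) (u x - u y) ^+ 2.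
Proof. by []. Qed.

Lemma dirichletC u v : dirichlet u v = dirichlet v u.
Proof.
by congr (_ * _); apply: eq_bigr => x _; apply: eq_bigr => y _; rewrite mulrC.
Qed.

Lemma dirichletDl u1 u2 v : dirichlet (u1 + u2) v = dirichlet u1 v + dirichlet u2 v.
Proof.
rewrite /dirichlet -mulrDr -big_split; congr (_ * _); apply: eq_bigr => x _ /=.
rewrite -big_split; apply: eq_bigr => y _ /=; rewrite !ffunE; ring.
Qed.

Lemma dirichlet_suml (I : finType) (a : I -> R) (h : I -> {ffun V -> R}) v :
  dirichlet [ffun x => \sum_i a i * h i x] v = \sum_i a i * dirichlet (h i) v.
Proof.
transitivity (2^-1 * \sum_x \sum_(y | e x y) \sum_i
    a i * ((h i x - h i y) * (v x - v y))).
  congr (_ * _); apply: eq_bigr => x _; apply: eq_bigr => y _.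
  rewrite !ffunE -sumrB mulr_suml; apply: eq_bigr => i _; ring.
under eq_bigr do rewrite exchange_big.
rewrite exchange_big mulr_sumr; apply: eq_bigr => i _ /=.
rewrite [RHS]mulrCA; congr (_ * _); rewrite mulr_sumr; apply: eq_bigr => x _.
by rewrite mulr_sumr.
Qed.

Lemma dirichlet_ge0 u : 0 <= dirichlet u u.
Proof.
rewrite mulr_ge0 ?invr_ge0 // sumr_ge0 // => x _.
by rewrite sumr_ge0 // => y _; rewrite -expr2 sqr_ge0.
Qed.

Hypothesis e_sym : symmetric e.

(** The double sum is symmetrised by exchanging the endpoints of each edge. *)
Lemma green u v : \sum_x u x * laplacian e v x = dirichlet u v.
Proof.
pose S := \sum_x \sum_(y | e x y) u x * (v x - v y).
have -> : \sum_x u x * laplacian e v x = S.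
  by apply: eq_bigr => x _; rewrite mulr_sumr.
have S' : S = \sum_x \sum_(y | e x y) u y * (v y - v x).
  rewrite /S (exchange_big_dep predT) //=; apply: eq_bigr => y _.
  by apply: eq_bigl => x; rewrite e_sym.
suff : S + S = \sum_x \sum_(y | e x y) (u x - u y) * (v x - v y).
  by rewrite /dirichlet => <-; field.
rewrite {2}S' -big_split; apply: eq_bigr => x _ /=.
by rewrite -big_split; apply: eq_bigr => y _ /=; ring.
Qed.

Hypothesis e_conn : graph_connected e.

Lemma dirichlet_eq0 u : dirichlet u u = 0 -> forall x y, u x = u y.
Proof.
move=> /eqP; rewrite mulf_eq0 invr_eq0 pnatr_eq0 /= => /eqP D0.
have sq_ge0 x y : 0 <= (u x - u y) * (u x - u y) by rewrite -expr2 sqr_ge0.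
have step x y : e x y -> u x = u y.
  have terms0 := psumr_eq0P (fun x _ => sumr_ge0 _ (fun y _ => sq_ge0 x y)) D0.
  move=> exy; have := psumr_eq0P (fun y _ => sq_ge0 x y) (terms0 x isT) exy.
  by move/eqP; rewrite mulf_eq0 orbb subr_eq0 => /eqP.
move=> x y; have [p + <-] := e_conn x y.
by elim: p x => //= z p IH x /andP[/step -> /IH].
Qed.

Variable z : V.
Hypothesis z_inner : z \in inner e.

(** Two adjacent vertices of degree one form a connected component, which would
leave no room for the inner vertex z. *)
Lemma bdry_neighbour_inner x y : x \in bdry e -> e x y -> y \in inner e.
Proof.
rewrite !inE => /cards1P[x' Nx] exy; apply/negP => /cards1P[y' Ny].
have xx' : x' = y by have/setP/(_ y) := Nx; rewrite !inE exy => /esym/eqP.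
have yy' : y' = x by have/setP/(_ x) := Ny; rewrite !inE e_sym exy => /esym/eqP.
rewrite {}xx' in Nx; rewrite {}yy' in Ny.
have closed p a : (a == x) || (a == y) -> path e a p ->
    (last a p == x) || (last a p == y).
  elim: p a => //= b p IH a axy /andP[ab]; apply: IH.
  by case/orP: axy ab => /eqP ->; [have := Nx|have := Ny] => /setP/(_ b);
    rewrite !inE => -> ->; rewrite ?orbT.
have [p pz lz] := e_conn x z; have := closed p x; rewrite eqxx pz lz.
case/(_ isT isT)/orP => /eqP zE; move: z_inner; rewrite zE !inE /deg.
  by rewrite Nx cards1.
by rewrite Ny cards1.
Qed.

(** The equations form a square linear system, so that uniqueness gives existence.
A solution of the homogeneous system has no Dirichlet energy by Green's
formula, hence is constant, and it vanishes on the boundary. *)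
Lemma harmonic_extension_exists (f : {ffun bdry_vertex e -> R}) x0 :
  x0 \in bdry e -> exists u, is_harmonic_extension f u.
Proof.
move=> bx0.
pose T := {ffun V -> R^o}.
pose L (u : T) : T :=
  [ffun x => if x \in inner e then laplacian e u x else u x].
have Llin : linear L.
  move=> a u v; apply/ffunP => x; rewrite !ffunE; case: ifP => _ //.
  transitivity (a * laplacian e u x + laplacian e v x); last by [].
  rewrite /laplacian mulr_sumr -big_split; apply: eq_bigr => y _ /=.
  by rewrite !ffunE /GRing.scale /=; ring.
pose lL := GRing.isLinear.Build R T T *:%R L Llin.
pose LL : {linear T -> T} := HB.pack L lL.
have inj : lker (linfun LL) == 0%VS.
  apply/lker0P => u v; rewrite !lfunE /= => Luv.
  pose d : {ffun V -> R} := u - v.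
  have Ld x : L d x = 0.
    have := linearB LL u v; rewrite /= -/d => ->; rewrite Luv subrr ffunE.
    by [].
  have d0 x : x \in bdry e -> d x = 0.
    by move=> bx; have := Ld x; rewrite ffunE inE bx.
  have/dirichlet_eq0 dc : dirichlet d d = 0.
    rewrite -green big1 // => x _; have := Ld x; rewrite ffunE.
    by case: ifP => [_ ->|_ ->]; rewrite ?mulr0 ?mul0r.
  apply/ffunP => x; have := dc x x0; rewrite (d0 x0) // !ffunE => /eqP.
  by rewrite subr_eq0 => /eqP.
pose g : T := [ffun x => if insub x is Some y then f y else 0].
pose u : T := ((linfun LL)^-1)%VF g.
have Lu : L u = g by have := lker0_lfunVK inj g; rewrite lfunE.
exists u; split=> [x ix|x].
  have/ffunP/(_ x) := Lu; rewrite !ffunE ix => ->.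
  by case: insubP => // y yb; move: ix; rewrite inE yb.
have/ffunP/(_ (val x)) := Lu; rewrite !ffunE inE (valP x) /= => ->.
by rewrite valK.
Qed.

Lemma harmonic_extensionP (f : {ffun bdry_vertex e -> R}) :
  is_harmonic_extension f (harmonic_extension f).
Proof.
have [x bx|none] := pickP (mem (bdry e)).
  have [u hu] := harmonic_extension_exists f bx.
  exact: (xgetPex 0 (ex_intro _ u hu)).
suff [u hu] : exists u, is_harmonic_extension f u.
  exact: (xgetPex 0 (ex_intro _ u hu)).
exists 0; split=> [x _|[x bx]]; last by have := none x; rewrite /= bx.
by rewrite /laplacian big1 // => y _; rewrite !ffunE subrr.
Qed.

Local Notation n := #|{: bdry_vertex e}|.

Definition basis_extension (i : 'I_n) : {ffun V -> R} :=
  harmonic_extension [ffun y : bdry_vertex e => (y == enum_val i)%:R].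

Lemma sum_bdry (F : V -> R) :
  \sum_(x in bdry e) F x = \sum_(i < n) F (val (enum_val i)).
Proof. by rewrite big_sub big_enum_val. Qed.

Lemma basis_extension_bdry i x : x \in bdry e ->
  basis_extension i x = (x == val (enum_val i))%:R.
Proof.
move=> bx; have [_ /(_ (Sub x bx))] := harmonic_extensionP
  [ffun y : bdry_vertex e => (y == enum_val i)%:R].
by rewrite SubK ffunE -val_eqE /= => ->.
Qed.

Lemma laplacian_bdry u x : x \in bdry e ->
  normal_derivative e u x = laplacian e u x.
Proof.
move=> bx; rewrite /normal_derivative /laplacian; apply: eq_bigl => y.
by case exy: (e x y); rewrite ?andbF // (bdry_neighbour_inner bx exy).
Qed.

(** Green's formula for two extensions h_i and h_j: the Laplacian of h_j vanishes
inside, and among the boundary vertices h_i only sees the i-th one. *)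
Lemma DtN_mxE i j :
  DtN_mx R e i j = dirichlet (basis_extension i) (basis_extension j).
Proof.
rewrite mxE ffunE laplacian_bdry ?(valP (enum_val i)) // -green.
rewrite (bigID (mem (inner e))) /= big1 ?add0r; last first.
  move=> x ix; have [-> //] := harmonic_extensionP
    [ffun y : bdry_vertex e => (y == enum_val j)%:R].
  by rewrite mulr0.
rewrite (bigD1 (val (enum_val i))) /=; last by rewrite inE (valP (enum_val i)).
rewrite basis_extension_bdry ?(valP (enum_val i)) // eqxx mul1r big1 ?addr0 //.
move=> x /andP[]; rewrite inE negbK => bx /negPf xi.
by rewrite basis_extension_bdry // xi mul0r.
Qed.

(** By linearity this is a harmonic extension of x, which avoids comparing it with
the chosen extension of the corresponding function on the boundary. *)
Definition combine_extensions (x : 'rV[R]_n) : {ffun V -> R} :=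
  [ffun w => \sum_i x 0 i * basis_extension i w].

Lemma combine_extensions_bdry x i :
  combine_extensions x (val (enum_val i)) = x 0 i.
Proof.
rewrite ffunE (bigD1 i) //= basis_extension_bdry ?(valP (enum_val i)) //.
rewrite eqxx mulr1 big1 ?addr0 // => j ji.
rewrite basis_extension_bdry ?(valP (enum_val i)) //.
by rewrite val_eqE (inj_eq enum_val_inj) eq_sym (negPf ji) mulr0.
Qed.

Lemma combine_extensions_inner x w :
  w \in inner e -> laplacian e (combine_extensions x) w = 0.
Proof.
move=> iw; transitivity (\sum_i x 0 i * laplacian e (basis_extension i) w).
  under [RHS]eq_bigr do rewrite mulr_sumr.
  rewrite [RHS]exchange_big; apply: eq_bigr => y _ /=.
  by rewrite !ffunE -sumrB; apply: eq_bigr => i _; rewrite mulrBr.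
rewrite big1 // => i _; have [-> //] := harmonic_extensionP
  [ffun y : bdry_vertex e => (y == enum_val i)%:R].
by rewrite mulr0.
Qed.

Lemma qform_DtN x :
  qform (DtN_mx R e) x = dirichlet (combine_extensions x) (combine_extensions x).
Proof.
rewrite dirichlet_suml; apply: eq_bigr => i _.
rewrite dirichletC dirichlet_suml mulr_sumr; apply: eq_bigr => j _.
by rewrite DtN_mxE dirichletC; ring.
Qed.

(** Dirichlet principle: a harmonic function h is orthogonal, for the Dirichlet
form, to every function u - h that vanishes on the boundary. *)
Lemma qform_DtN_le (x : 'rV[R]_n) u : (forall i, u (val (enum_val i)) = x 0 i) ->
  qform (DtN_mx R e) x <= dirichlet u u.
Proof.
move=> ux; rewrite qform_DtN; set h := combine_extensions x.
have uE : u = (u - h) + h by rewrite subrK.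
have ort : dirichlet (u - h) h = 0.
  rewrite -green big1 // => w _.
  have [iw|] := boolP (w \in inner e).
    by rewrite combine_extensions_inner ?mulr0.
  rewrite inE negbK => bw.
  pose i : 'I_n := enum_rank (Sub w bw : bdry_vertex e).
  have wE : w = val (enum_val i) by rewrite enum_rankK SubK.
  by rewrite !ffunE wE ux -[in _ - _](combine_extensions_bdry x) ffunE subrr mul0r.
have -> : dirichlet u u = dirichlet (u - h) (u - h) + dirichlet h h.
  have split_u w : dirichlet u w = dirichlet (u - h) w + dirichlet h w.
    by rewrite {1}uE dirichletDl.
  rewrite split_u (dirichletC (u - h) u) (dirichletC h u) !split_u ort.
  by rewrite (dirichletC h (u - h)) ort addr0 add0r.
by rewrite lerDr dirichlet_ge0.
Qed.

Lemma steklov_spectrumP : is_spectrum (DtN_mx R e) (steklov_spectrum R e).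
Proof.
have symA : (DtN_mx R e)^T = DtN_mx R e.
  by apply/matrixP => i j; rewrite mxE !DtN_mxE dirichletC.
have [s sP] := symmetric_spectrum_exists symA.
exact: (xgetPex [::] (ex_intro _ s sP)).
Qed.

Lemma DtN_mx_sym : (DtN_mx R e)^T = DtN_mx R e.
Proof. by apply/matrixP => i j; rewrite mxE !DtN_mxE dirichletC. Qed.

Lemma card_bdry : n = #|bdry e|.
Proof. by rewrite card_sig. Qed.

(** On functions of mean zero on the boundary, a translation by c can only increase
the sum of the squares, so the Poincare inequality may use any c. *)
Lemma lambda2_ge (mu : R) : 0 <= mu -> (1 < #|bdry e|)%N ->
    (forall u, exists c, mu * (\sum_(x in bdry e) (u x - c) ^+ 2) <= dirichlet u u) ->
  mu <= lambda2 R e.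
Proof.
move=> mu0 n1 poincare.
apply: (le_second_eigenvalue (v := const_mx 1) DtN_mx_sym steklov_spectrumP).
  by rewrite card_bdry.
move=> x sx; rewrite qform_DtN; have [c] := poincare (combine_extensions x).
apply: le_trans; rewrite ler_wpM2l // sum_bdry.
under [leRHS]eq_bigr do rewrite combine_extensions_bdry.
have x0 : \sum_i x 0 i = 0.
  by rewrite -[RHS]sx; apply: eq_bigr => i _; rewrite mxE mulr1.
rewrite -subr_ge0 -sumrB.
have -> : \sum_i ((x 0 i - c) ^+ 2 - x 0 i ^+ 2) = \sum_(i < n) c ^+ 2.
  transitivity (\sum_(i < n) c ^+ 2 - 2 * c * \sum_i x 0 i).
    by rewrite mulr_sumr -sumrB; apply: eq_bigr => i _; ring.
  by rewrite x0 mulr0 subr0.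
by rewrite sumr_ge0 // => i _; rewrite sqr_ge0.
Qed.

(** The Rayleigh quotient is at most mu on the plane spanned by 1 and u: adding a
constant to u preserves the energy and increases the sum of the squares. *)
Lemma lambda2_le (mu : R) u x0 : (1 < #|bdry e|)%N ->
    x0 \in bdry e -> u x0 != 0 -> \sum_(x in bdry e) u x = 0 ->
    dirichlet u u <= mu * (\sum_(x in bdry e) u x ^+ 2) ->
  lambda2 R e <= mu.
Proof.
move=> n1 bx0 ux0 su Du.
pose f : 'rV[R]_n := \row_i u (val (enum_val i)).
have su2 : 0 < \sum_(x in bdry e) u x ^+ 2.
  rewrite (bigD1 x0) //= ltr_pwDl ?sumr_ge0 // => [|i _]; last exact: sqr_ge0.
  by rewrite lt_def sqrf_eq0 ux0 sqr_ge0.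
have mu0 : 0 <= mu.
  rewrite -(pmulr_lge0 _ su2) (le_trans (dirichlet_ge0 u)) //.
have sf : \sum_i f 0 i = 0.
  by rewrite -[RHS]su sum_bdry; apply: eq_bigr => i _; rewrite mxE.
apply: (second_eigenvalue_le (u := const_mx 1) (v := f) DtN_mx_sym steklov_spectrumP).
- by rewrite card_bdry.
- move=> a b ab0.
  have comb i : a + b * f 0 i = 0.
    by have/rowP/(_ i) := ab0; rewrite !mxE mulr1.
  have a0 : a = 0.
    have : \sum_i (a + b * f 0 i) = 0 by rewrite big1.
    rewrite big_split /= -mulr_sumr sf mulr0 addr0 sumr_const card_ord.
    by move/eqP; rewrite mulrn_eq0 card_bdry; case: #|_| n1 => // ? _ /eqP.
  split=> //; have := comb (enum_rank (Sub x0 bx0 : bdry_vertex e)).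
  rewrite a0 add0r mxE enum_rankK SubK => /eqP.
  by rewrite mulf_eq0 (negPf ux0) orbF => /eqP.
move=> a b /=; set x := _ + _.
have xE i : x 0 i = a + b * f 0 i by rewrite !mxE mulr1.
apply: le_trans (@qform_DtN_le x [ffun w => a + b * u w] _) _.
  by move=> i; rewrite xE ffunE !mxE.
have -> : dirichlet [ffun w => a + b * u w] [ffun w => a + b * u w] =
    b ^+ 2 * dirichlet u u.
  rewrite !dirichletE [RHS]mulrCA; congr (_ * _); rewrite mulr_sumr; apply: eq_bigr => w _.
  by rewrite mulr_sumr; apply: eq_bigr => y _; rewrite !ffunE; ring.
have -> : \sum_i x 0 i ^+ 2 = \sum_(i < n) a ^+ 2 + b ^+ 2 * \sum_i f 0 i ^+ 2.
  transitivity (\sum_(i < n) a ^+ 2 + b ^+ 2 * \sum_i f 0 i ^+ 2 +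
      2 * a * b * \sum_i f 0 i); last by rewrite sf mulr0 addr0.
  rewrite !mulr_sumr -!big_split; apply: eq_bigr => i _ /=.
  by rewrite xE; ring.
have -> : \sum_i f 0 i ^+ 2 = \sum_(x in bdry e) u x ^+ 2.
  by rewrite sum_bdry; apply: eq_bigr => i _; rewrite mxE.
rewrite mulrDr (mulrCA mu (b ^+ 2)); apply: ler_wpDl.
  by rewrite mulr_ge0 // sumr_ge0 // => i _; rewrite sqr_ge0.
by rewrite ler_wpM2l // sqr_ge0.
Qed.

End SteklovVariational.

(** * The first Steklov eigenvalue of a refined ball *)

(** Each edge occurs twice in the Dirichlet form, once for each orientation, and
the vertices other than the root index the edges oriented downwards. *)
Lemma dirichlet_rooted (R : realType) (V : finType) (e : rel V) o p h
    (u : {ffun V -> R}) : rooted e o p h ->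
  dirichlet e u u = \sum_(x | x != o) (u x - u (p x)) ^+ 2.
Proof.
move=> rt; have [adj desc] := rt.
pose g x y := (u x - u y) ^+ 2.
pose up x y := (x != o) && (y == p x).
have gC x y : g x y = g y x by rewrite /g -sqrrN opprB.
have sum_up : \sum_x \sum_(y | up x y) g x y = \sum_(x | x != o) g x (p x).
  rewrite [RHS]big_mkcond; apply: eq_bigr => x _; rewrite /up.
  by case: (x != o); rewrite ?big_pred0_eq // big_pred1_eq.
have -> : dirichlet e u u = 2^-1 * \sum_x \sum_(y | e x y) g x y by [].
suff -> : \sum_x \sum_(y | e x y) g x y =
    \sum_x \sum_(y | up x y) g x y + \sum_x \sum_(y | up y x) g x y.
  rewrite [X in _ + X](exchange_big_dep predT) //=.
  under [X in _ + X]eq_bigr do under eq_bigr do rewrite gC.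
  by rewrite sum_up /g; field.
rewrite -big_split; apply: eq_bigr => x _ /=.
transitivity (\sum_y ((if up x y then g x y else 0) +
    (if up y x then g x y else 0))); last by rewrite big_split -!big_mkcond.
rewrite big_mkcond; apply: eq_bigr => y _.
rewrite adj -/(up x y) -/(up y x).
case uxy: (up x y); case uyx: (up y x); rewrite ?addr0 ?add0r //.
move: uxy uyx => /andP[xo /eqP yE] /andP[yo /eqP xE].
by have := desc x xo; have := desc y yo; rewrite -yE -xE; lia.
Qed.

(** The difference of the two sides is half the sum of all (a_i - a_j)^2. *)
Lemma sqr_sum_le (R : realFieldType) n (a : 'I_n -> R) :
  (\sum_i a i) ^+ 2 <= n%:R * \sum_i a i ^+ 2.
Proof.
have : 0 <= \sum_i \sum_j (a i - a j) ^+ 2.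
  by rewrite sumr_ge0 // => i _; rewrite sumr_ge0 // => j _; rewrite sqr_ge0.
have -> : \sum_i \sum_j (a i - a j) ^+ 2 =
    2 * (n%:R * \sum_i a i ^+ 2 - (\sum_i a i) ^+ 2).
  transitivity (\sum_i (n%:R * a i ^+ 2 + \sum_j a j ^+ 2 - 2 * a i * \sum_j a j)).
    apply: eq_bigr => i _.
    have -> : n%:R * a i ^+ 2 = \sum_(j < n) a i ^+ 2.
      by rewrite sumr_const card_ord mulr_natl.
    rewrite mulr_sumr -big_split -sumrB.
    by apply: eq_bigr => j _ /=; ring.
  rewrite sumrB big_split /= -mulr_sumr sumr_const card_ord -mulr_suml -mulr_sumr.
  by rewrite -mulr_natl; ring.
by rewrite pmulr_rge0 // subr_ge0.
Qed.

Section Bounds.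
Variables (R : realType) (V : finType) (e : rel V) (o : V) (p : V -> V).
Variables (h : V -> nat) (l : nat).
Hypothesis ball_e : ternary_ball e o p h l.
Hypothesis l_gt0 : (0 < l)%N.

Local Notation W := (refined_vertex e h).
Local Notation G := (@refined_adj V e h).

Let rt : rooted e o p h. Proof. by case: ball_e. Qed.
Let ho : h o = 0%N. Proof. by case: ball_e. Qed.
Let hp x : x != o -> h x = (h (p x)).+1. Proof. by case: ball_e => _ _ + _ _; apply. Qed.

(** The part of the Dirichlet energy carried by the path that replaces the edge
between y and its parent. *)
Definition edge_energy (u : {ffun W -> R}) (y : V) : R :=
  \sum_(i < h y) (u (node e h (p y, y) i.+1) - u (node e h (p y, y) i)) ^+ 2.

Lemma dirichlet_refined (u : {ffun W -> R}) :
  dirichlet G u u = \sum_(y | y != o) edge_energy u y.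
Proof.
rewrite (dirichlet_rooted u (refined_rooted rt hp)) (sum_refined rt hp).
apply: eq_bigr => y yo; apply: eq_bigr => i _.
have uy : upward e h (p y, y) by rewrite (upwardE rt hp) yo eqxx.
have iy : (i <= added e h (p y, y))%N by rewrite -ltnS (added_parent rt hp).
by rewrite /refined_parent; have [-> -> _] := edge_node rt hp uy iy.
Qed.

(** A path of h y edges is a resistor of resistance h y. *)
Lemma edge_energy_ge (u : {ffun W -> R}) y : y != o ->
  (u (inl y) - u (inl (p y))) ^+ 2 <= (h y)%:R * edge_energy u y.
Proof.
move=> yo; apply: le_trans (sqr_sum_le _).
rewrite -(big_mkord predT (fun i => u (node e h (p y, y) i.+1) - u (node e h (p y, y) i))).
by rewrite telescope_sumr // -(added_parent rt hp yo) node_last.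
Qed.

Lemma bdry_refined : bdry G = [set inl x | x in bdry e].
Proof.
apply/setP => w; rewrite inE (deg_refined rt hp); case: w => [x|v].
  by rewrite mem_imset ?inE // => ? ? [].
by apply/esym/imsetP => -[].
Qed.

Lemma sum_bdry_refined (F : W -> R) :
  \sum_(w in bdry G) F w = \sum_(y | h y == l) F (inl y).
Proof.
rewrite bdry_refined big_imset /=; last by move=> ? ? _ _ [].
by apply: eq_bigl => y; rewrite (bdry_ball ball_e l_gt0) inE.
Qed.

Lemma card_bdry_refined : #|bdry G| = (3 * 2 ^ l.-1)%N.
Proof.
rewrite bdry_refined card_imset; last by move=> ? ? [].
by rewrite (bdry_ball ball_e l_gt0) (card_level ball_e) // l_gt0 leqnn.
Qed.

Lemma refined_tree : is_tree G.
Proof. exact: rooted_is_tree (refined_rooted rt hp). Qed.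

Lemma root_inner : (inl o : W) \in inner G.
Proof.
rewrite !inE (deg_refined rt hp) (deg_ball ball_e) // ho.
by case: (l) l_gt0.
Qed.

(** The effective resistance sum_(1 <= k <= j) k / 2^(k-1) between the root and
level j inside one branch, multiplied by the number 2^(j-1) of vertices of
that level in the branch. *)
Definition scaled_resistance j : R := 2 ^+ j.+1 - j.+2%:R.

Lemma scaled_resistance1 : scaled_resistance 1 = 1.
Proof. by rewrite /scaled_resistance; ring. Qed.

Lemma scaled_resistanceS j : scaled_resistance j.+1 = 2 * scaled_resistance j + j.+1%:R.
Proof. by rewrite /scaled_resistance exprS -!natr1; ring. Qed.

Lemma scaled_resistance_gt0 j : (0 < j)%N -> 0 < scaled_resistance j.
Proof.
case: j => // j _; elim: j => [|j IH]; first by rewrite scaled_resistance1 ltr01.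
by rewrite scaled_resistanceS ltr_wpDr // mulr_gt0.
Qed.

(** The difference of the two sides is (m a - 2 b d)^2 / (2 b m). The weights are
those for which equality holds when the increment d and the value a are in the
proportion m : 2b of the resistances. *)
Lemma weighted_sqrD (b m a d : R) : 0 < b -> 0 < m ->
  (a + d) ^+ 2 <= (2 * b + m) / (2 * b) * a ^+ 2 + (2 * b + m) / m * d ^+ 2.
Proof.
move=> b0 m0; rewrite -subr_ge0.
have -> : (2 * b + m) / (2 * b) * a ^+ 2 + (2 * b + m) / m * d ^+ 2 - (a + d) ^+ 2
    = (m * a - 2 * b * d) ^+ 2 / (2 * b * m).
  by field; rewrite !gt_eqF.
by rewrite divr_ge0 ?sqr_ge0 // !mulr_ge0 // ltW.
Qed.

(** The energy of all edges up to level j controls the sum of g^2 over level j,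
with the constant [scaled_resistance j]. In the induction step, the weights of
[weighted_sqrD] make the parent term and the energy of the new edges appear
with one and the same constant [scaled_resistance j.+1], because every value on
level j is used by two children. *)
Lemma level_poincare (g E : V -> R) : g o = 0 -> (forall y, 0 <= E y) ->
    (forall y, y != o -> (g y - g (p y)) ^+ 2 <= (h y)%:R * E y) ->
  \sum_(y | h y == l) g y ^+ 2 <= scaled_resistance l * \sum_(y | y != o) E y.
Proof.
move=> go E0 gE.
suff claim j : (0 < j <= l)%N -> \sum_(y | h y == j) g y ^+ 2 <=
    scaled_resistance j * \sum_(y | (y != o) && (h y <= j)%N) E y.
  have := claim l; rewrite l_gt0 leqnn => /(_ isT)/le_trans; apply.
  apply: ler_wpM2l; first exact/ltW/scaled_resistance_gt0.
  rewrite [leRHS](bigID (fun y => h y <= l)%N) /=.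
  by rewrite lerDl sumr_ge0.
elim: j => // -[_ _|j IH jl].
  rewrite scaled_resistance1 mul1r.
  rewrite [leRHS](eq_bigl (fun y => h y == 1%N)); last first.
    by move=> y; rewrite -(level_eq0 ball_e); case: (h y) => [|[|]].
  apply: ler_sum => y /eqP hy.
  have yo : y != o by rewrite -(level_eq0 ball_e) hy.
  have := gE y yo; rewrite hy mul1r.
  have /eqP -> : p y == o by rewrite -(level_eq0 ball_e) -eqSS -hp // hy.
  by rewrite go subr0.
have j0 : 0 < scaled_resistance j.+1 by rewrite scaled_resistance_gt0.
have m0 : 0 < j.+2%:R :> R by rewrite ltr0n.
set B := scaled_resistance j.+1 in IH j0.
have B'E : scaled_resistance j.+2 = 2 * B + j.+2%:R by rewrite scaled_resistanceS.
have B'0 : 0 < scaled_resistance j.+2 by rewrite scaled_resistance_gt0.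
apply: (@le_trans _ _ (\sum_(y | h y == j.+2)
    (scaled_resistance j.+2 / (2 * B) * g (p y) ^+ 2 + scaled_resistance j.+2 * E y))).
  apply: ler_sum => y /eqP hy.
  have yo : y != o by rewrite -(level_eq0 ball_e) hy.
  rewrite -{1}(subrKC (g (p y)) (g y)) B'E.
  apply: le_trans (weighted_sqrD _ _ j0 m0) _; rewrite lerD2l -mulrA.
  rewrite -B'E ler_pM2l //.
  rewrite mulrC ler_pdivrMr // mulrC.
  by have := gE y yo; rewrite hy.
rewrite big_split /= -!mulr_sumr (sum_level_step ball_e (fun x => g x ^+ 2)); last by lia.
have -> : scaled_resistance j.+2 / (2 * B) * ((\sum_(x | h x == j.+1) g x ^+ 2) *+ 2) =
    scaled_resistance j.+2 * (B^-1 * \sum_(x | h x == j.+1) g x ^+ 2).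
  by field; rewrite gt_eqF.
rewrite -mulrDr ler_pM2l //.
rewrite [leRHS](bigID (fun y => h y <= j.+1)%N) /=; apply: lerD.
  rewrite mulrC ler_pdivrMr // mulrC; apply: le_trans (IH _) _; first by rewrite (ltnW jl).
  rewrite ler_pM2l // le_eqVlt; apply/orP; left; apply/eqP.
  by apply: eq_bigl => y; case: (y != o) => //=; lia.
rewrite le_eqVlt; apply/orP; left; apply/eqP; apply: eq_bigl => y.
by rewrite -(level_eq0 ball_e); lia.
Qed.

(** [level_poincare] for u - u root, whose constant is less than 2^(l+1). *)
Lemma lambda2_refined_ge : 3 / (4 * #|bdry G|%:R) <= lambda2 R G.
Proof.
have [sym _ conn _] := refined_tree.
have -> : 3 / (4 * #|bdry G|%:R) = (2 ^+ l.+1)^-1 :> R.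
  rewrite card_bdry_refined natrM natrX.
  case: (l) l_gt0 => // k _; rewrite !exprS /=; field.
  by rewrite expf_neq0 ?pnatr_eq0.
apply: (lambda2_ge sym conn root_inner); first by rewrite invr_ge0 exprn_ge0.
  by rewrite card_bdry_refined; have := expn_gt0 2 l.-1; lia.
move=> u; exists (u (inl o)); rewrite dirichlet_refined sum_bdry_refined.
rewrite mulrC ler_pdivrMr ?exprn_gt0 //.
apply: le_trans (@level_poincare (fun y => u (inl y) - u (inl o)) (edge_energy u) _ _ _) _.
- by rewrite subrr.
- by move=> y; rewrite sumr_ge0 // => i _; rewrite sqr_ge0.
- move=> y yo; apply: le_trans (edge_energy_ge u yo).
  by rewrite le_eqVlt; apply/orP; left; apply/eqP; ring.
rewrite mulrC ler_wpM2l //.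
  by rewrite sumr_ge0 // => y _; rewrite sumr_ge0 // => i _; rewrite sqr_ge0.
by rewrite /scaled_resistance gerBl.
Qed.

Section TestFunction.
Variables c1 c2 : V.
Hypothesis c12 : c1 != c2.
Hypothesis hc1 : h c1 = 1%N.
Hypothesis hc2 : h c2 = 1%N.

(** The ancestor of y on level 1. *)
Definition branch (y : V) : V := iter (h y).-1 p y.
Definition sign (y : V) : R := (branch y == c1)%:R - (branch y == c2)%:R.

Lemma sign_parent y : (1 < h y)%N -> sign (p y) = sign y.
Proof.
move=> hy; have yo : y != o by rewrite -(level_eq0 ball_e); case: (h y) hy.
have hpy := hp yo; rewrite /sign /branch hpy /=.
case: (h (p y)) hpy hy => [->//|k] _ _ /=.
by rewrite -iterSr.
Qed.

Lemma branch1 y : h y = 1%N -> branch y = y.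
Proof. by rewrite /branch => ->. Qed.

Lemma sum_sign1 (F : R -> R) : F 0 = 0 ->
  \sum_(y | h y == 1%N) F (sign y) = F 1 + F (- 1).
Proof.
move=> F0; rewrite (bigD1 c1) ?hc1 //= (bigD1 c2) /=; last first.
  by rewrite hc2 eqxx eq_sym c12.
rewrite /sign !branch1 // !eqxx (negPf c12) eq_sym (negPf c12) subr0 sub0r.
rewrite big1 ?addr0 // => y /andP[/andP[/eqP hy /negPf y1] /negPf y2].
by rewrite branch1 // y1 y2 subr0.
Qed.

(** On each level j > 0, the sign is 1 on the 2^(j-1) descendants of c1, -1 on
those of c2 and 0 elsewhere. *)
Lemma sum_sign (F : R -> R) j : F 0 = 0 -> (0 < j <= l)%N ->
  \sum_(y | h y == j) F (sign y) = (F 1 + F (- 1)) * 2 ^+ j.-1.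
Proof.
move=> F0; elim: j => // -[_ _|j IH jl]; first by rewrite sum_sign1 // mulr1.
rewrite (eq_bigr (fun y => F (sign (p y)))); last first.
  by move=> y /eqP hy; rewrite sign_parent // hy.
rewrite (sum_level_step ball_e (fun x => F (sign x))); last by lia.
rewrite IH; last by lia.
by rewrite /= exprS -mulr_natl; ring.
Qed.

Definition profile (k : nat) : R := if k is k'.+1 then if k' is 0%N then 2 else 4 else 0.

(** On the branch of c1, this is four times the potential that is 0 at the root
and 1 on level 2 and beyond. Between the root and level 2 there are an edge of
resistance 1 and then two paths of resistance 2 in parallel, so the potential
is 1/2 on level 1, and 3/4 at the only vertex added to an edge above it. *)
Definition test_fun : {ffun W -> R} := [ffun w =>
  match w with
  | inl x => sign x * profile (h x)
  | inr v => sign (tag v).2 * (if h (tag v).2 == 2%N then 3 else 4)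
  end].

(** The values of the test function along the path leading to a vertex of level k,
up to sign. *)
Definition profile_at (k i : nat) : R :=
  if k == 1%N then 2 * i%:R else if k == 2%N then 2 + i%:R else 4.

Lemma test_fun_node y i : y != o -> (i <= h y)%N ->
  test_fun (node e h (p y, y) i) = sign y * profile_at (h y) i.
Proof.
move=> yo ih; have hpy := hp yo; have add := added_parent rt hp yo.
case: i ih => [|i] ih.
  rewrite ffunE /=; case hy: (h y) hpy => [|[|k]] // -[hpy].
    by rewrite -hpy /profile_at /= !mulr0.
  rewrite -hpy sign_parent ?hy //; congr (_ * _).
  by case: k {hy hpy} => [|k]; rewrite /profile_at /= ?addr0.
have [iE|i_lt] := eqVneq i.+1 (h y).
  rewrite iE -{1}add node_last ffunE /=; congr (_ * _).
  by case: (h y) hpy => [|[|[|k]]] // _; rewrite /profile_at /= ?mulr1 // -natrD.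
have i_add : (i < added e h (p y, y))%N by rewrite -ltnS add ltn_neqAle i_lt ih.
rewrite /= insubT ffunE /=; congr (_ * _); rewrite /profile_at.
have -> : (h y == 1%N) = false by lia.
have [hy|//] := eqVneq (h y) 2%N.
have -> : i = 0%N by lia.
by rewrite -natrD.
Qed.

Lemma test_fun_energy y : y != o -> edge_energy test_fun y =
  (if h y == 1%N then 4 * sign y ^+ 2 else 0) +
  (if h y == 2%N then 2 * sign y ^+ 2 else 0).
Proof.
move=> yo; transitivity (\sum_(i < h y)
    (sign y * profile_at (h y) i.+1 - sign y * profile_at (h y) i) ^+ 2).
  by apply: eq_bigr => i _; rewrite !test_fun_node // ltnW.
have : (0 < h y)%N by rewrite hp.
case: (h y) => [|[|[|k]]] // _; rewrite /profile_at /=.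
- by rewrite big_ord_recl big_ord0 /=; ring.
- by rewrite !big_ord_recl big_ord0 /=; ring.
by rewrite big1 ?addr0 // => i _; ring.
Qed.

Lemma dirichlet_test_fun : (1 < l)%N -> dirichlet G test_fun test_fun = 16.
Proof.
move=> l1; rewrite dirichlet_refined (eq_bigr _ test_fun_energy).
transitivity (\sum_(y | h y == 1%N) 4 * sign y ^+ 2 + \sum_(y | h y == 2%N) 2 * sign y ^+ 2).
  rewrite big_split /= -!big_mkcondr; congr (_ + _); apply: eq_bigl => y.
    by rewrite -(level_eq0 ball_e); lia.
  by rewrite -(level_eq0 ball_e); lia.
rewrite (@sum_sign (fun x => 4 * x ^+ 2)) ?l_gt0 //; last by ring.
rewrite (@sum_sign (fun x => 2 * x ^+ 2)) //; last by ring.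
by rewrite /=; ring.
Qed.

Lemma sum_test_fun : (1 < l)%N -> \sum_(w in bdry G) test_fun w = 0.
Proof.
move=> l1; rewrite sum_bdry_refined.
rewrite (eq_bigr (fun y => 4 * sign y)); last first.
  move=> y /eqP hy; rewrite ffunE hy mulrC.
  by case: (l) l1 => [|[]].
rewrite (@sum_sign (fun x => 4 * x)) ?mulr0 ?l_gt0 ?leqnn //.
by ring.
Qed.

Lemma sum_sqr_test_fun : (1 < l)%N ->
  \sum_(w in bdry G) test_fun w ^+ 2 = 16 * 2 ^+ l.
Proof.
move=> l1; rewrite sum_bdry_refined.
rewrite (eq_bigr (fun y => 16 * sign y ^+ 2)); last first.
  move=> y /eqP hy; rewrite ffunE hy.
  by case: (l) l1 => [|[|k]] // _ /=; ring.
rewrite (@sum_sign (fun x => 16 * x ^+ 2)) ?l_gt0 ?leqnn //; last by ring.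
by case: (l) l_gt0 => // k _; rewrite [2 ^+ k.+1]exprS /=; ring.
Qed.

(** The Rayleigh quotient of the test function is 16 / (16 2^l). *)
Lemma lambda2_refined_le_branches : (1 < l)%N -> lambda2 R G <= 3 / (2 * #|bdry G|%:R).
Proof.
move=> l1; have [sym _ conn _] := refined_tree.
have -> : 3 / (2 * #|bdry G|%:R) = (2 ^+ l)^-1 :> R.
  rewrite card_bdry_refined natrM natrX.
  case: (l) l_gt0 => // k _; rewrite !exprS /=; field.
  by rewrite expf_neq0 ?pnatr_eq0.
have l2 : (2 ^+ l : R) != 0 by rewrite expf_neq0 ?pnatr_eq0.
have [w bw uw] : exists2 w, w \in bdry G & test_fun w != 0.
  have [w /andP[bw uw]|none] := pickP (fun w => (w \in bdry G) && (test_fun w != 0)).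
    by exists w.
  have := sum_sqr_test_fun l1; rewrite big1 => [/esym/eqP|w bw].
    by rewrite mulf_eq0 pnatr_eq0 (negPf l2).
  by have := none w; rewrite bw /= => /negbFE/eqP ->; rewrite expr0n.
apply: (lambda2_le sym conn root_inner _ bw uw (sum_test_fun l1)).
  by rewrite card_bdry_refined; have := expn_gt0 2 l.-1; lia.
rewrite dirichlet_test_fun // sum_sqr_test_fun // mulrCA mulVf // mulr1.
by [].
Qed.

End TestFunction.

Lemma lambda2_refined_le : (1 < l)%N -> lambda2 R G <= 3 / (2 * #|bdry G|%:R).
Proof.
move=> l1; have : (1 < #|[set x | h x == 1%N]|)%N by rewrite (card_level ball_e) ?l_gt0.
case/card_gt1P => c1 [c2 []]; rewrite !inE => /eqP hc1 /eqP hc2 c12.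
exact: lambda2_refined_le_branches c12 hc1 hc2 l1.
Qed.

End Bounds.

(** * The family of trees *)

(** A closed form for the sum of the 3 2^k path lengths k.+1, written without
subtraction. *)
Lemma sum_doubling_weights l :
  (\sum_(0 <= k < l) 3 * 2 ^ k * k.+1 + 3 * 2 ^ l = 3 * l * 2 ^ l + 3)%N.
Proof.
elim: l => [|l IH]; first by rewrite big_nil.
rewrite big_nat_recr //= expnS; lia.
Qed.

Section Cardinality.
Variables (V : finType) (e : rel V) (o : V) (p : V -> V) (h : V -> nat) (l : nat).
Hypothesis ball_e : ternary_ball e o p h l.
Hypothesis l_gt0 : (0 < l)%N.
Local Notation W := (refined_vertex e h).
Local Notation G := (@refined_adj V e h).
Local Open Scope nat_scope.

Lemma card_refined_ball : #|W| = #|V| + \sum_(1 <= k < l) 3 * 2 ^ k * k.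
Proof.
have [rt _ hp _ _] := ball_e.
rewrite (card_refined rt hp) (sum_by_level ball_e predn).
by rewrite big_ltn // muln0 add0n.
Qed.

Lemma card_refined_closed : #|W| + 3 * 2 ^ l = 3 * l * 2 ^ l + 4.
Proof.
rewrite card_refined_ball (card_ball ball_e).
have -> : \sum_(1 <= k < l) 3 * 2 ^ k * k = \sum_(0 <= k < l) 3 * 2 ^ k * k.
  by rewrite [RHS]big_ltn // muln0 add0n.
have := sum_doubling_weights l.
under eq_bigr do rewrite mulnS.
by rewrite big_split /=; lia.
Qed.

Lemma card_refined_bounds : l * #|bdry G| <= #|W| <= 2 * l * #|bdry G|.
Proof.
rewrite (card_bdry_refined ball_e l_gt0); have := card_refined_closed.
have := expn_gt0 2 l.-1.
case: (l) l_gt0 => // k _ /=; rewrite expnS.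
by case: k => [|k]; nia.
Qed.
End Cardinality.

Lemma refined_ball_estimates (R : realType) (T : choiceType) (e : rel T) (o : T) (l : nat) :
    homogeneous_tree e 3 -> (1 <= l)%N ->
  let G1 := G1_adj e o l in
  let G := G_adj e o l in
  let N := #|bdry G| in
  [/\ is_tree G1, is_tree G & forall u, (deg G u <= 3)%N] /\
  [/\ N = #|bdry G1|, N = (3 * 2 ^ (l - 1))%N,
      (l * N <= #|G_vertex e o l|)%N,
      #|G_vertex e o l| = (#|G1_vertex e o l| + \sum_(1 <= k < l) 3 * 2 ^ k * k)%N &
      (#|G_vertex e o l| <= 2 * l * N)%N] /\
  3 / (4 * N%:R) <= lambda2 R G /\
  ((2 <= l)%N -> lambda2 R G <= 3 / (2 * N%:R)).
Proof.
move=> hom l0; have [r [p bl]] := G1_ternary_ball o l hom.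
have [rt _ hp _ _] := bl.
have NE := card_bdry_refined bl l0.
split; first split.
- exact: rooted_is_tree rt.
- exact: refined_tree bl.
- move=> w; rewrite /G_adj (deg_refined rt hp); case: w => [x|//].
  by rewrite (deg_ball bl) //; case: (_ == l).
split; last by split; [exact: lambda2_refined_ge bl l0|exact: lambda2_refined_le bl l0].
have /andP[lo hi] := card_refined_bounds bl l0.
split=> //; last exact: card_refined_ball bl l0.
- by rewrite /G_adj NE (bdry_ball bl) // (card_level bl) // l0 leqnn.
- by rewrite /G_adj NE subn1.
Qed.

(** As l #|boundary| <= #|V|, the lower bound 3 / (4 #|boundary|) is at least
(3 l / 4) / #|V|, and it remains to take l > 4 c / 3. *)
Lemma lambda2_beats_linear (R : realType) (T : choiceType) (e : rel T) (o : T) :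
    homogeneous_tree e 3 -> forall (D : nat) (c : R), (3 <= D)%N -> 0 < c ->
  exists l : nat, [/\ (1 <= l)%N,
    forall u, (deg (G_adj e o l) u <= D)%N &
    c / #|G_vertex e o l|%:R < lambda2 R (G_adj e o l)].
Proof.
move=> hom D c D3 c0.
pose l := (Num.bound (4 * c / 3)).+1.
have lc : 4 * c / 3 < l%:R.
  have c' : 0 <= 4 * c / 3 by rewrite divr_ge0 // mulr_ge0 // ltW.
  by apply: lt_trans (archi_boundP c') _; rewrite ltr_nat.
exists l; have := @refined_ball_estimates R T e o l hom isT.
cbv zeta; set N := #|_| => -[[_ _ deg3] [[_ NE lo _ _] [ge _]]].
split=> // [u|]; first exact: leq_trans (deg3 u) D3.
apply: lt_le_trans ge.
have N0 : 0 < N%:R :> R by rewrite ltr0n NE muln_gt0 expn_gt0.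
have lo' : l%:R * N%:R <= #|G_vertex e o l|%:R :> R by rewrite -natrM ler_nat.
have V0 : 0 < #|G_vertex e o l|%:R :> R.
  by apply: lt_le_trans lo'; rewrite mulr_gt0.
rewrite ltr_pdivrMr // mulrAC ltr_pdivlMr ?mulr_gt0 //.
move: lc; rewrite ltr_pdivrMr // => lc.
have : 4 * c * N%:R < l%:R * 3 * N%:R by rewrite ltr_pM2r.
nra.
Qed.

Theorem theorem3p6 (R : realType) :
  [/\ (* the trees G obtained from T_3, o and l *)
      forall (T : choiceType) (e : rel T) (o : T) (l : nat),
        homogeneous_tree e 3 -> (1 <= l)%N ->
        let G1 := G1_adj e o l in
        let G := G_adj e o l in
        let N := #|bdry G| in
        [/\ is_tree G1, is_tree G & forall u, (deg G u <= 3)%N] /\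
        [/\ N = #|bdry G1|,
            N = (3 * 2 ^ (l - 1))%N,
            (l * N <= #|G_vertex e o l|)%N,
            #|G_vertex e o l| = (#|G1_vertex e o l| + \sum_(1 <= k < l) 3 * 2 ^ k * k)%N &
            (#|G_vertex e o l| <= 2 * l * N)%N] /\
        3 / (4 * N%:R) <= lambda2 R G /\
        (* the star obtained for l = 1 has lambda_2 = 1 and three leaves *)
        ((2 <= l)%N -> lambda2 R G <= 3 / (2 * N%:R)),
      (* these trees beat any bound c / |V| *)
      exists (T : choiceType) (e : rel T) (o : T),
        homogeneous_tree e 3 /\
        forall (D : nat) (c : R), (3 <= D)%N -> 0 < c ->
        exists l : nat,
          [/\ (1 <= l)%N,
              forall u, (deg (G_adj e o l) u <= D)%N &
              c / #|G_vertex e o l|%:R < lambda2 R (G_adj e o l)] &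
      (* hence no bound of the form c(D) / |V| *)
      forall D : nat, (3 <= D)%N -> ~ exists2 c : R, 0 < c & is_linear_bound D c].
Proof.
split=> [T e o l hom l0||D D3 [c c0 bound]].
- exact: refined_ball_estimates.
- exists nat, heap_adj, 0%N; split; first exact: heap_homogeneous.
  exact/lambda2_beats_linear/heap_homogeneous.
have [l [l1 degD]] := lambda2_beats_linear 0%N heap_homogeneous D3 c0.
have [[_ treeG _] [[_ NE lo _ _] _]] :=
  @refined_ball_estimates R nat heap_adj 0%N l heap_homogeneous l1.
rewrite ltNge => /negP; apply; apply: bound => //.
apply: leq_trans lo; rewrite NE.
by have := expn_gt0 2 (l - 1); nia.
Qed.
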